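(* Let $N$ be a positive integer. As formal power series in $z$ and $p$, $$\sum_{\substack{n\ge0\\ \pi\in C_N\wr S_n}}\frac{z^n}{(p;q)_{n+1}}\,t^{\mathrm{exc}(\pi)}r^{\vec{\mathrm{fix}}(\pi)}s^{\vec{\mathrm{col}}(\pi)}q^{\mathrm{maj}(\pi)}p^{\mathrm{des}^*(\pi)}$$ $$=\sum_{l\ge0}\frac{p^l(1-tq)(z;q)_l(tqz;q)_l\left(\prod_{m=1}^{N-1}(s_mz;q)_l\right)}{\left(\prod_{m=1}^{N-1}(r_ms_mz;q)_l\right)(r_0z;q)_{l+1}\left[\left(1+\sum_{m=1}^{N-1}s_m\right)(z;q)_l-\left(tq+\sum_{m=1}^{N-1}s_m\right)(tqz;q)_l\right]}.$$
   Context: $[n]=\{1,\dots,n\}$; $(a;q)_0=1$ and $(a;q)_n=(1-a)(1-aq)\cdots(1-aq^{n-1})$ for $n\ge1$. For vectors, $r^{\vec\alpha}=r_0^{\alpha_0}\cdots r_{N-1}^{\alpha_{N-1}}$ and $s^{\vec\beta}=s_1^{\beta_1}\cdots s_{N-1}^{\beta_{N-1}}$. Colored permutations: an element $\pi\in C_N\wr S_n$ is a word $\pi=\pi_1\cdots\pi_n$ whose letters are $\pi_i=|\pi_i|^{\epsilon_i}$ with $|\pi_i|\in[n]$ and color $\epsilon_i\in\{0,\dots,N-1\}$, such that $|\pi_1|\cdots|\pi_n|$ is a permutation of $[n]$. Letters are totally ordered by $1^{N-1}<2^{N-1}<\dots<n^{N-1}<1^{N-2}<\dots<n^{N-2}<\dots<1^0<\dots<n^0$.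 Statistics: $\mathrm{DES}(\pi)=\{i\in[n-1]:\pi_i>\pi_{i+1}\}$, $\mathrm{maj}(\pi)=\sum_{i\in\mathrm{DES}(\pi)}i$; $\mathrm{DES}^*(\pi)=\mathrm{DES}(\pi)$ if $\epsilon_1=0$ and $\mathrm{DES}^*(\pi)=\mathrm{DES}(\pi)\cup\{0\}$ if $\epsilon_1>0$, and $\mathrm{des}^*(\pi)=|\mathrm{DES}^*(\pi)|$; $\mathrm{exc}(\pi)=|\{i\in[n]:\pi_i>i^0\}|$; $\mathrm{fix}_k(\pi)=|\{i\in[n]:\pi_i=i^k\}|$ for $0\le k\le N-1$ and $\vec{\mathrm{fix}}(\pi)=(\mathrm{fix}_0(\pi),\dots,\mathrm{fix}_{N-1}(\pi))$; $\mathrm{col}_m(\pi)=|\{i\in[n]:\epsilon_i=m\}|$ for $1\le m\le N-1$ and $\vec{\mathrm{col}}(\pi)=(\mathrm{col}_1(\pi),\dots,\mathrm{col}_{N-1}(\pi))$. For $n=0$ there is only the empty word, all of whose statistics are zero. *)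

(* Defs.v *)
From HB Require Import structures.
From mathcomp Require Import all_boot all_order all_algebra all_fingroup.
From mathcomp Require Import boolp.

Set Implicit Arguments.
Unset Strict Implicit.
Unset Printing Implicit Defensive.

Import GRing.Theory.
Local Open Scope ring_scope.

(* The ring R[[x]] of formal power series; its units are the series whose     *)
(* constant coefficient is a unit of R.                                       *)

Record fps (R : Type) := Fps { fps_coef : nat -> R }.

Section FpsRing.
Variable R : comUnitRingType.
Implicit Types f g h : fps R.

HB.instance Definition _ := gen_eqMixin (fps R).
HB.instance Definition _ := gen_choiceMixin (fps R).

Lemma fpsP f g : (forall n, fps_coef f n = fps_coef g n) -> f = g.
Proof. by case: f g => [f] [g] /= fg; congr Fps; apply/funext. Qed.

Definition fpsC (c : R) : fps R := Fps (fun n => if n == 0%N then c else 0).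
Definition fpsX : fps R := Fps (fun n => (n == 1%N)%:R).
Definition fps_add f g : fps R := Fps (fun n => fps_coef f n + fps_coef g n).
Definition fps_opp f : fps R := Fps (fun n => - fps_coef f n).
Definition fps_mul f g : fps R :=
  Fps (fun n => \sum_(i < n.+1) fps_coef f i * fps_coef g (n - i)%N).

(* The coefficients of orders 0, ..., n of f^-1, obtained by solving          *)
(* f * f^-1 = 1 order by order.                                               *)
Fixpoint fps_inv_seq f (n : nat) : seq R :=
  if n is m.+1 then
    let s := fps_inv_seq f m in
    rcons s (- (fps_coef f 0)^-1 *
             \sum_(i < m.+1) fps_coef f i.+1 * nth 0 s (m - i)%N)
  else [:: (fps_coef f 0)^-1].

Definition fps_unit : {pred fps R} :=
  fun f => fps_coef f 0 \is a GRing.unit.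

Definition fps_inv f : fps R :=
  if f \in fps_unit then Fps (fun n => nth 0 (fps_inv_seq f n) n) else f.

Lemma fps_addA : associative fps_add.
Proof. by move=> f g h; apply: fpsP => n /=; rewrite addrA. Qed.
Lemma fps_addC : commutative fps_add.
Proof. by move=> f g; apply: fpsP => n /=; rewrite addrC. Qed.
Lemma fps_add0 : left_id (fpsC 0) fps_add.
Proof. by move=> f; apply: fpsP => n /=; rewrite if_same add0r. Qed.
Lemma fps_addN : left_inverse (fpsC 0) fps_opp fps_add.
Proof. by move=> f; apply: fpsP => n /=; rewrite if_same addNr. Qed.

HB.instance Definition _ :=
  GRing.isZmodule.Build (fps R) fps_addA fps_addC fps_add0 fps_addN.

Let trunc n f : {poly R} := \poly_(i < n.+1) fps_coef f i.

Let coef_trunc n f k : (k <= n)%N -> (trunc n f)`_k = fps_coef f k.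
Proof. by move=> kn; rewrite coef_poly ltnS kn. Qed.

Let coef_mul n f g k : (k <= n)%N ->
  fps_coef (fps_mul f g) k = (trunc n f * trunc n g)`_k.
Proof.
move=> kn; rewrite coefM /=; apply: eq_bigr => i _.
rewrite !coef_trunc //; first exact: leq_trans (leq_subr _ _) kn.
by apply: leq_trans kn; rewrite -ltnS.
Qed.

Lemma fps_mulA : associative fps_mul.
Proof.
move=> f g h; apply: fpsP => n.
transitivity ((trunc n f * (trunc n g * trunc n h))`_n).
  rewrite coefM /=; apply: eq_bigr => i _.
  by rewrite -(coef_mul _ _ (leq_subr _ _)) coef_trunc // -ltnS.
rewrite mulrA coefM /=; apply: eq_bigr => i _.
rewrite -(@coef_mul n f g i) -1?ltnS // (@coef_trunc n h) //.
exact: leq_subr.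
Qed.

Lemma fps_mulC : commutative fps_mul.
Proof.
by move=> f g; apply: fpsP => n; rewrite !(@coef_mul n) // mulrC.
Qed.

Lemma fps_mul1 : left_id (fpsC 1) fps_mul.
Proof.
move=> f; apply: fpsP => n /=.
rewrite big_ord_recl /= mul1r subn0 big1 ?addr0 // => i _.
by rewrite mul0r.
Qed.

Lemma fps_mulDl : left_distributive fps_mul fps_add.
Proof.
move=> f g h; apply: fpsP => n /=; rewrite -big_split /=.
by apply: eq_bigr => i _; rewrite mulrDl.
Qed.

Lemma fps_1neq0 : fpsC 1 != fpsC 0.
Proof.
apply/eqP => /(congr1 (fun f => fps_coef f 0)) /= /eqP.
by rewrite oner_eq0.
Qed.

HB.instance Definition _ := GRing.Zmodule_isComNzRing.Build (fps R)
  fps_mulA fps_mulC fps_mul1 fps_mulDl fps_1neq0.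

Lemma size_fps_inv_seq f n : size (fps_inv_seq f n) = n.+1.
Proof. by elim: n => //= n IH; rewrite size_rcons IH. Qed.

Lemma nth_fps_inv_seq f n k : (k <= n)%N ->
  nth 0 (fps_inv_seq f n) k = nth 0 (fps_inv_seq f k) k.
Proof.
elim: n => [|n IH]; first by rewrite leqn0 => /eqP->.
rewrite leq_eqVlt => /orP[/eqP-> //|]; rewrite ltnS => kn.
by rewrite /= nth_rcons size_fps_inv_seq ltnS kn IH.
Qed.

Lemma fps_mulV : {in fps_unit, left_inverse 1 fps_inv *%R}.
Proof.
move=> f fU; rewrite mulrC; apply: fpsP => -[|n].
  rewrite /= big_ord1 /fps_inv fU /= divrr //.
rewrite /= big_ord_recl /fps_inv fU /= subn0 nth_rcons size_fps_inv_seq.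
rewrite ltnn eqxx mulrA mulrN divrr // mulN1r.
apply/eqP; rewrite addrC subr_eq0; apply/eqP; apply: eq_bigr => i _.
by rewrite /bump /= add1n subSS (@nth_fps_inv_seq f n) ?leq_subr.
Qed.

Lemma fps_unitPl f g : g * f = 1 -> fps_unit f.
Proof.
move=> /(congr1 (fun f => fps_coef f 0)) /=; rewrite big_ord1 subnn => gf1.
by apply/unitrPr; exists (fps_coef g 0); rewrite mulrC.
Qed.

Lemma fps_inv_out : {in [predC fps_unit], fps_inv =1 id}.
Proof. by move=> f /negbTE; rewrite /fps_inv => ->. Qed.

HB.instance Definition _ := GRing.ComNzRing_hasMulInverse.Build (fps R)
  fps_mulV fps_unitPl fps_inv_out.

End FpsRing.

Arguments fpsX {R}.

(* Power series in two variables: fps (fps R) = R[[z]][[p]], z inner.         *)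
Section TwoVariables.
Variable R : comUnitRingType.

Definition fps2C (c : R) : fps (fps R) := fpsC (fpsC c).
Definition fps2z : fps (fps R) := fpsC fpsX.
Definition fps2p : fps (fps R) := fpsX.

Definition fps2_coef (F : fps (fps R)) (i j : nat) : R :=
  fps_coef (fps_coef F j) i.

(* The infinite series \sum_k F k converges formally to S: the coefficient    *)
(* of every z^i p^j in its partial sums is eventually that of S.              *)
Definition fps2_has_sum (F : nat -> fps (fps R)) (S : fps (fps R)) : Prop :=
  forall i j, exists M, forall m, (M <= m)%N ->
    fps2_coef (\sum_(k < m) F k) i j = fps2_coef S i j.

End TwoVariables.

Definition qpoch (A : comUnitRingType) (a q : A) (n : nat) : A :=
  \prod_(i < n) (1 - a * q ^+ i).

(* The colored permutation pi in C_N wr S_n is the pair (|pi|, epsilon).      *)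
Definition colperm (N n : nat) : finType :=
  ({perm 'I_n} * {ffun 'I_n -> 'I_N})%type.

(* A letter is a pair (absolute value, color).  Everything is shifted to      *)
(* 'I_n = {0, ..., n-1}: the ordinal j stands both for the position j+1 and   *)
(* for the absolute value j+1, so that `letter w j' is pi_{j+1}.              *)
Section Statistics.
Variables N n : nat.
Implicit Types w : colperm N n.

Definition color w (j : 'I_n) : nat := w.2 j.
Definition letter w (j : 'I_n) : nat * nat := (nat_of_ord (w.1 j), color w j).

(* Higher colors come first: 1^{N-1} < ... < n^{N-1} < ... < 1^0 < ... < n^0. *)
Definition letter_lt (a b : nat * nat) : bool :=
  (b.2 < a.2)%N || (a.2 == b.2) && (a.1 < b.1)%N.

(* Descent sets are subsets of {0, ..., n-1}, on which no shift is made: the  *)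
(* ordinal i > 0 is the descent i, comparing pi_i = letter w j (j = i - 1)    *)
(* with pi_{i+1} = letter w i.                                                *)
Definition DES w : {set 'I_n} :=
  [set i : 'I_n |
    [exists j : 'I_n, (j.+1 == i) && letter_lt (letter w i) (letter w j)]].

Definition maj w : nat := (\sum_(i in DES w) i)%N.

(* Here pi_1 is the letter at the ordinal 0.                                  *)
Definition DES_star w : {set 'I_n} :=
  DES w :|: [set i : 'I_n | (nat_of_ord i == 0%N) && (0 < color w i)%N].

Definition des_star w : nat := #|DES_star w|.

Definition exc w : nat :=
  #|[set i : 'I_n | letter_lt (nat_of_ord i, 0%N) (letter w i)]|.

Definition fix_ (k : nat) w : nat :=
  #|[set i : 'I_n | letter w i == (nat_of_ord i, k)]|.

Definition col_ (m : nat) w : nat := #|[set i : 'I_n | color w i == m]|.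

End Statistics.

(* Main.v *)
(* For fixed l, the coefficient of p^l in q^maj p^des* / (p;q)_{n+1} is the sum of
   q^(f_1 + ... + f_n) over the sequences l >= f_1 >= ... >= f_n >= 0 that decrease
   strictly at DES*.  Label the position i by f_i, the color of pi_i and the type
   of i (|pi_i| < i, = i or > i).  When labels are ordered suitably, pi and f are
   compatible if and only if the labels increase weakly along the positions and
   |pi| increases on each block of equal labels; on such a block, |pi_i| - i has
   constant sign.  Moving the label of i to the place |pi_i| gives a word, from
   which standardization recovers pi and f.  The words so obtained are those in
   which each column can only hold certain letters, according to the block of that
   column in the sorted word: those of given content are counted by a coefficient
   of a product of linear forms.  Extracting one variable after the other, their
   generating function, for a final segment of the alphabet and k letters owed to
   the preceding ones, is alpha^k phi with scalars alpha and phi; adding a letter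
   acts on alpha by a Moebius map, which becomes affine in terms of
   W = 1 / (1 + alpha).  Solving this recursion gives the l-th term of the right
   hand side. *)

Require Import Defs.
From HB Require Import structures.
From mathcomp Require Import all_boot all_order all_algebra all_fingroup.
From mathcomp Require Import zify ring.

Set Implicit Arguments.
Unset Strict Implicit.
Unset Printing Implicit Defensive.

Import GRing.Theory.
Local Open Scope ring_scope.


(** * Formal power series *)

Arguments fps_mul : simpl never.
Arguments fps_add : simpl never.
Arguments fps_opp : simpl never.

Section FpsTheory.
Variable R : comUnitRingType.
Implicit Types f g : fps R.

Lemma fps_coef0 n : fps_coef (0 : fps R) n = 0.
Proof. by rewrite /= if_same. Qed.

Lemma fps_coef1 n : fps_coef (1 : fps R) n = (n == 0)%:R.
Proof. by case: n. Qed.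

Lemma fps_coefD f g n : fps_coef (f + g) n = fps_coef f n + fps_coef g n.
Proof. by []. Qed.

Lemma fps_coefN f n : fps_coef (- f) n = - fps_coef f n.
Proof. by []. Qed.

Lemma fps_coefM f g n :
  fps_coef (f * g) n = \sum_(i < n.+1) fps_coef f i * fps_coef g (n - i)%N.
Proof. by []. Qed.

Lemma fps_coef_sum (I : Type) (r : seq I) (P : pred I) (F : I -> fps R) n :
  fps_coef (\sum_(i <- r | P i) F i) n = \sum_(i <- r | P i) fps_coef (F i) n.
Proof.
exact: (big_morph (fun f => fps_coef f n) (fun f g => fps_coefD f g n)
                  (fps_coef0 n)).
Qed.

Definition fps_coefr (n : nat) (f : fps R) : R := fps_coef f n.

Lemma fps_coefr_zmod n : zmod_morphism (fps_coefr n).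
Proof. by []. Qed.

HB.instance Definition _ n :=
  GRing.isZmodMorphism.Build (fps R) R (fps_coefr n) (fps_coefr_zmod n).

Lemma fps_coef_natr m n :
  fps_coef (m%:R : fps R) n = if n == 0%N then m%:R else 0.
Proof.
rewrite -[LHS]/(fps_coefr n _) raddfMn /=.
by case: n => // n; rewrite mul0rn.
Qed.

Lemma fps_coefM0 f g : fps_coef (f * g) 0 = fps_coef f 0 * fps_coef g 0.
Proof. by rewrite fps_coefM big_ord1. Qed.

Lemma fpsC_zmod : zmod_morphism (@fpsC R).
Proof. by move=> a b; apply: fpsP => -[|n] /=; rewrite ?subr0. Qed.

Lemma fpsC_monoid : monoid_morphism (@fpsC R).
Proof.
split=> // a b; apply: fpsP => n; rewrite fps_coefM big_ord_recl /= subn0.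
rewrite big1 ?addr0 => [|i _]; last by rewrite mul0r.
by case: n => [|n]; rewrite ?mulr0.
Qed.

HB.instance Definition _ :=
  GRing.isZmodMorphism.Build R (fps R) (@fpsC R) fpsC_zmod.
HB.instance Definition _ :=
  GRing.isMonoidMorphism.Build R (fps R) (@fpsC R) fpsC_monoid.

Lemma fps_coefCM c f n : fps_coef (fpsC c * f) n = c * fps_coef f n.
Proof.
rewrite fps_coefM big_ord_recl /= subn0 big1 ?addr0 // => i _.
by rewrite mul0r.
Qed.

Lemma fps_coefXM f n :
  fps_coef (fpsX * f) n = if n is m.+1 then fps_coef f m else 0.
Proof.
rewrite fps_coefM big_ord_recl /= mul0r add0r; case: n => [|n].
  by rewrite big_ord0.
rewrite big_ord_recl /= mul1r subSS subn0 big1 ?addr0 // => i _.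
by rewrite mul0r.
Qed.

Lemma fps_coefXnM f k n :
  fps_coef (fpsX ^+ k * f) n = if (k <= n)%N then fps_coef f (n - k) else 0.
Proof.
elim: k n => [|k IH] n; first by rewrite expr0 mul1r subn0.
by rewrite exprS -mulrA fps_coefXM; case: n => [|n] //; rewrite IH.
Qed.

Lemma fps_unitE f : (f \is a GRing.unit) = (fps_coef f 0 \is a GRing.unit).
Proof. by []. Qed.

Lemma fps_unit1 f : fps_coef f 0 = 1 -> f \is a GRing.unit.
Proof. by rewrite fps_unitE => ->; rewrite unitr1. Qed.

Lemma fps_unit_1subX f : 1 - f * fpsX \is a GRing.unit.
Proof.
by apply: fps_unit1; rewrite fps_coefD fps_coefN fps_coefM0 /= mulr0 subr0.
Qed.

Lemma fps_unit_1subXl f : 1 - fpsX * f \is a GRing.unit.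
Proof. by rewrite mulrC fps_unit_1subX. Qed.

(** The substitution x |-> c x. *)
Definition fps_scale (c : R) f : fps R := Fps (fun n => c ^+ n * fps_coef f n).

Lemma fps_scale_zmod c : zmod_morphism (fps_scale c).
Proof. by move=> f g; apply: fpsP => n /=; rewrite mulrBr. Qed.

Lemma fps_scale_monoid c : monoid_morphism (fps_scale c).
Proof.
split=> [|f g]; first by apply: fpsP => -[|n] /=; rewrite ?mulr1 ?mulr0.
apply: fpsP => n /=; rewrite mulr_sumr; apply: eq_bigr => i _.
by rewrite mulrACA -exprD subnKC // -ltnS.
Qed.

HB.instance Definition _ c :=
  GRing.isZmodMorphism.Build (fps R) (fps R) (fps_scale c) (fps_scale_zmod c).
HB.instance Definition _ c :=
  GRing.isMonoidMorphism.Build (fps R) (fps R) (fps_scale c)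
    (fps_scale_monoid c).

Lemma fps_scaleX c : fps_scale c fpsX = fpsC c * fpsX.
Proof.
by apply: fpsP => -[|[|n]]; rewrite fps_coefCM /= ?expr1 ?mulr0.
Qed.

Lemma fps_scaleC c a : fps_scale c (fpsC a) = fpsC a.
Proof. by apply: fpsP => -[|n] /=; rewrite ?mul1r ?mulr0. Qed.

(* Substituting the inner variable of R[[x]][[y]] for the outer one. *)
Definition fps_diag (F : fps (fps R)) : fps R :=
  Fps (fun n => \sum_(c < n.+1) fps_coef (fps_coef F c) (n - c)).

Lemma fps_diag_zmod : zmod_morphism fps_diag.
Proof. by move=> f g; apply: fpsP => n /=; rewrite -sumrB. Qed.

Lemma fps_diagC f : fps_diag (fpsC f) = f.
Proof.
apply: fpsP => n /=; rewrite big_ord_recl /= subn0 big1 ?addr0 // => i _.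
exact: fps_coef0.
Qed.

Lemma fps_coef_diag F n : fps_coef (fps_diag F) n =
  \sum_(c < n.+1) fps_coef (fps_coef F c) (n - c).
Proof. by []. Qed.

HB.instance Definition _ :=
  GRing.isZmodMorphism.Build (fps (fps R)) (fps R) fps_diag fps_diag_zmod.

End FpsTheory.

Lemma fps_recl (R : comUnitRingType) (f : fps R) :
  f = fpsC (fps_coef f 0) + fpsX * Fps (fun n => fps_coef f n.+1).
Proof.
apply: fpsP => n; rewrite fps_coefD fps_coefXM.
by case: n => [|n]; rewrite /= ?addr0 ?add0r.
Qed.

Section FpsDiag.
Variable R : comUnitRingType.
Implicit Types (f : fps R) (F G : fps (fps R)).

Lemma fps_diagXM F : fps_diag (fpsX * F) = fpsX * fps_diag F.
Proof.
apply: fpsP => n; rewrite fps_coefXM fps_coef_diag big_ord_recl.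
rewrite fps_coefXM fps_coef0 add0r; case: n => [|n].
  by rewrite big_ord0.
by rewrite fps_coef_diag; apply: eq_bigr => i _; rewrite fps_coefXM.
Qed.

Lemma fps_diagD F G : fps_diag (F + G) = fps_diag F + fps_diag G.
Proof. exact: raddfD. Qed.

Lemma fps_diag_recl F :
  fps_diag F =
  fps_coef F 0 + fpsX * fps_diag (Fps (fun n => fps_coef F n.+1)).
Proof. by rewrite {1}[F]fps_recl raddfD /= fps_diagC fps_diagXM. Qed.

Lemma fps_diagCM f F : fps_diag (fpsC f * F) = f * fps_diag F.
Proof.
apply: fpsP => n; elim: n F => [|n IH] F; rewrite fps_diag_recl;
  rewrite (fps_diag_recl F) mulrDr mulrCA fps_coefCM !fps_coefD !fps_coefXM //.
congr (_ + _); rewrite -IH; congr (fps_coef (fps_diag _) _).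
apply: fpsP => m; rewrite fps_coefCM.
by rewrite -[LHS]/(fps_coef (fpsC f * F) m.+1) fps_coefCM.
Qed.

(** Splitting off the constant term of [F] leaves a multiple of the outer variable, whose image is a
    multiple of x: the induction hypothesis applies at the previous order. *)
Lemma fps_diag_monoid : monoid_morphism (@fps_diag R).
Proof.
split=> [|F G]; first by rewrite -[1]/(fpsC 1) fps_diagC.
apply: fpsP => n; elim: n F => [|n IH] F; rewrite {1}[F]fps_recl;
  rewrite (fps_diag_recl F) !mulrDl -!mulrA fps_diagD fps_diagXM fps_diagCM;
  rewrite !fps_coefD !fps_coefXM //.
by rewrite IH.
Qed.

HB.instance Definition _ :=
  GRing.isMonoidMorphism.Build (fps (fps R)) (fps R) (@fps_diag R)
    fps_diag_monoid.

Lemma fps_diagM F G : fps_diag (F * G) = fps_diag F * fps_diag G.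
Proof. exact: rmorphM. Qed.

Lemma fps_diagXn F n : fps_diag (F ^+ n) = fps_diag F ^+ n.
Proof. exact: rmorphXn. Qed.

Lemma fps_diagX : fps_diag (fpsX : fps (fps R)) = fpsX.
Proof. by rewrite -[fpsX in LHS]mulr1 fps_diagXM rmorph1 mulr1. Qed.

End FpsDiag.

Section Binomials.
Variable R : comUnitRingType.

Lemma fps_coef_geom (y : R) n :
  fps_coef (1 - fpsC y * fpsX)^-1 n = y ^+ n.
Proof.
set f := Fps (fun n => y ^+ n).
suff -> : (1 - fpsC y * fpsX)^-1 = f by [].
apply: (mulrI (fps_unit_1subX (fpsC y))); rewrite divrr ?fps_unit_1subX //.
apply: fpsP => m; rewrite mulrBl mul1r fps_coefD fps_coefN -mulrA fps_coefCM.
rewrite fps_coefXM fps_coef1; case: m => [|m] /=.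
  by rewrite mulr0 subr0.
by rewrite exprS subrr.
Qed.

Lemma fps_coef_negbin (y : R) k n :
  fps_coef ((1 - fpsC y * fpsX)^-1 ^+ k.+1) n = y ^+ n *+ 'C(k + n, n).
Proof.
elim: k n => [|k IH] n.
  by rewrite expr1 fps_coef_geom add0n binn mulr1n.
elim: n => [|n IHn].
  rewrite exprS fps_coefM0 IH fps_coef_geom.
  by rewrite !bin0 !expr0 !mulr1n mulr1.
set g := _^-1 in IH IHn *.
(* The source of Pascal's rule: g = 1 + y x g, multiplied by g^(k+1). *)
have gE : g ^+ k.+2 = g ^+ k.+1 + fpsX * (fpsC y * g ^+ k.+2).
  rewrite {2}exprS [fpsC y * _]mulrA mulrA mulrA -{1}[g ^+ k.+1]mul1r.
  rewrite -mulrDl exprS; congr (_ * _).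
  rewrite -[1](@divrr _ (1 - fpsC y * fpsX)) ?fps_unit_1subX // -/g.
  by rewrite mulrBl mul1r [fpsX * _]mulrC subrK.
rewrite gE fps_coefD fps_coefXM fps_coefCM IHn IH.
rewrite mulrnAr -exprS -mulrnDr; congr (_ *+ _).
by rewrite [in RHS]addSn binS addSnnS.
Qed.

Lemma fps_coef_bin (a y : R) k n :
  fps_coef ((fpsC a + fpsC y * fpsX) ^+ k) n =
  a ^+ (k - n) * y ^+ n *+ 'C(k, n).
Proof.
elim: k n => [|k IH] n.
  rewrite expr0 fps_coef1; case: n => [|n]; rewrite ?bin0 ?expr0 ?mulr1 //.
rewrite exprS mulrDl fps_coefD fps_coefCM -mulrA fps_coefCM fps_coefXM.
case: n => [|n].
  by rewrite mulr0 addr0 IH !bin0 !subn0 !mulr1n mulrA -exprS.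
rewrite !IH binS subSS mulrnDr !mulrnAr; congr (_ + _).
  have [nk|kn] := ltnP n k; last by rewrite bin_small // !mulr0n.
  by rewrite mulrA -exprS -subSn.
by rewrite mulrCA -exprS.
Qed.

End Binomials.
Arguments fps_coef : simpl never.


(** * Weakly decreasing sequences *)

Lemma big_tuple_cons (A : Type) (idx : A) (op : Monoid.com_law idx)
    (T : finType) n (P : pred (n.+1.-tuple T)) (F : n.+1.-tuple T -> A) :
  \big[op/idx]_(t | P t) F t =
  \big[op/idx]_(x : T) \big[op/idx]_(t : n.-tuple T | P (cons_tuple x t))
     F (cons_tuple x t).
Proof.
rewrite pair_big_dep /=.
rewrite (reindex (fun u : T * n.-tuple T => cons_tuple u.1 u.2)) //=.
exists (fun t : n.+1.-tuple T => (thead t, behead_tuple t)) => [[x t]|t] _ /=.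
  by rewrite theadE; congr pair; apply: val_inj.
by rewrite [RHS]tuple_eta; apply: val_inj.
Qed.

(* The sequences l >= s_0 >= s_1 >= ..., the i-th inequality being strict when
   D i holds. *)
Fixpoint desc_seq (D : nat -> bool) (l : nat) (s : seq nat) : bool :=
  if s is a :: s' then (a + D 0%N <= l)%N && desc_seq (D \o succn) a s'
  else true.

Section DescentSeries.
Variables (R : comUnitRingType) (q : R).

(** With p as series variable and [D] the indicator of DES*, this is q^maj p^des* / (p;q)_{n+1}. *)
Definition desc_fps n (D : nat -> bool) : fps R :=
  (\prod_(i < n) (fpsX * fpsC q ^+ i) ^+ D i) / qpoch fpsX (fpsC q) n.+1.

Lemma qpoch_fpsX_unit (c : fps R) n : qpoch fpsX c n \is a GRing.unit.
Proof. by apply/unitr_prodP => i _; rewrite fps_unit_1subXl. Qed.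

(* The first entry a of the sequence is the bound of the remaining ones: hence
   the substitution p |-> q p. *)
Lemma desc_fpsS n D : desc_fps n.+1 D =
  fpsX ^+ D 0%N * ((1 - fpsC 1 * fpsX)^-1
                   * fps_scale q (desc_fps n (D \o succn))).
Proof.
rewrite /desc_fps /qpoch big_ord_recl [\prod_(_ < n.+2) _]big_ord_recl.
rewrite !expr0 !mulr1 mul1r.
have U k : \prod_(i < k) (1 - fpsX * fpsC q ^+ i.+1) \is a @GRing.unit (fps R).
  by apply/unitr_prodP => i _; rewrite fps_unit_1subXl.
have V : 1 - fpsX \is a @GRing.unit (fps R).
  by rewrite -[fpsX]mulr1 fps_unit_1subXl.
rewrite rmorphM rmorphV ?qpoch_fpsX_unit // !rmorph_prod.
rewrite invrM //=; last exact: U.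
have scaleX i : fps_scale q (fpsX * fpsC q ^+ i) = fpsX * fpsC q ^+ i.+1.
  by rewrite rmorphM rmorphXn /= fps_scaleX fps_scaleC exprS; ring.
rewrite (eq_bigr (fun i : 'I_n => (fpsX * fpsC q ^+ i.+1) ^+ D i.+1)) //.
rewrite [in RHS](eq_bigr (fun i : 'I_n => (fpsX * fpsC q ^+ i.+1) ^+ D i.+1)).
  rewrite [X in _ = _ * (_ * (_ * X^-1))](eq_bigr
    (fun i : 'I_n.+1 => 1 - fpsX * fpsC q ^+ i.+1)).
    by rewrite -mulrA; congr (_ * _); rewrite [RHS]mulrCA; congr (_ * _);
       rewrite mulrC.
  by move=> i _; rewrite rmorphB rmorph1 /= scaleX.
by move=> i _; rewrite rmorphXn /= scaleX.
Qed.

(** The bound [L] keeps the type of the entries fixed while the induction replaces [l] with the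
    first entry. *)
Lemma desc_fps_coef L n D l : (l < L)%N ->
  fps_coef (desc_fps n D) l =
  \sum_(f : n.-tuple 'I_L | desc_seq D l (map val f)) q ^+ sumn (map val f).
Proof.
elim: n D l => [|n IH] D l lL.
  rewrite /desc_fps big_ord0 mul1r /qpoch big_ord1 expr0 mulr1.
  rewrite -[X in (1 - X)^-1]mul1r fps_coef_geom expr1n.
  by rewrite (big_pred1 [tuple]) ?expr0 // => t; rewrite tuple0 /= eqxx.
rewrite desc_fpsS fps_coefXnM big_tuple_cons /=.
transitivity (\sum_(a < L | (a + D 0 <= l)%N)
    q ^+ a * fps_coef (desc_fps n (D \o succn)) a); last first.
  rewrite [LHS]big_mkcond; apply: eq_bigr => a _.
  case: ifP => aD; last by rewrite big_pred0 // => t; rewrite aD.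
  rewrite IH // mulr_sumr; apply: eq_bigr => t _ /=.
  by rewrite exprD.
case: ifP => Dl; last first.
  rewrite big_pred0 // => a; apply/negbTE/negP => h.
  by rewrite (leq_trans (leq_addl a _) h) in Dl.
rewrite mulrC fps_coefM.
have le1 : ((l - D 0%N).+1 <= L)%N by apply: leq_ltn_trans lL; apply: leq_subr.
under eq_bigr do rewrite fps_coef_geom expr1n mulr1.
rewrite (big_ord_widen L
  (fun a => q ^+ a * fps_coef (desc_fps n (D \o succn)) a) le1).
by apply: eq_bigl => a; rewrite ltnS leq_subRL // addnC.
Qed.

End DescentSeries.


(** * Counting words of given content *)

(* Polynomials in k variables.  The first variable is the innermost one, so that
   removing the first letter of an alphabet enlarges the coefficient ring: most
   inductions below are for all rings S. *)
Fixpoint tpoly (k : nat) (S : comNzRingType) : comNzRingType :=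
  if k is k'.+1 then tpoly k' {poly S} else S.

Fixpoint tpolyC (k : nat) (S : comNzRingType) : {rmorphism S -> tpoly k S} :=
  match k return {rmorphism S -> tpoly k S} with
  | 0 => idfun
  | k'.+1 => (tpolyC k' {poly S} \o polyC : {rmorphism _ -> _})
  end.

(* The coefficient of the monomial with exponents c. *)
Fixpoint tcoef (k : nat) (S : comNzRingType) (c : seq nat) :
    tpoly k S -> S :=
  match k return tpoly k S -> S with
  | 0 => id
  | k'.+1 => fun p : tpoly k' {poly S} => (tcoef (behead c) p)`_(head 0%N c)
  end.

Lemma tcoefD k S c : {morph @tcoef k S c : p r / p + r}.
Proof. by elim: k S c => //= k IH S c p r; rewrite IH coefD. Qed.

Lemma tcoef0 k S c : @tcoef k S c 0 = 0.
Proof. by elim: k S c => //= k IH S c; rewrite IH coef0. Qed.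

Lemma tcoefB k S c : {morph @tcoef k S c : p r / p - r}.
Proof.
by move=> p r; apply/eqP; rewrite eq_sym subr_eq -tcoefD subrK.
Qed.

Lemma tcoef_sum k S c (I : Type) (r : seq I) P (F : I -> tpoly k S) :
  tcoef c (\sum_(i <- r | P i) F i) = \sum_(i <- r | P i) tcoef c (F i).
Proof. exact: (big_morph _ (@tcoefD k S c) (@tcoef0 k S c)). Qed.

Lemma tcoefMn k S c (p : tpoly k S) m : tcoef c (p *+ m) = tcoef c p *+ m.
Proof. by elim: m => [|m IH]; rewrite ?mulr0n ?tcoef0 // !mulrS tcoefD IH. Qed.

Lemma tcoefCM k (S : comNzRingType) c (a : S) p :
  tcoef c (tpolyC k S a * p) = a * tcoef c p.
Proof. by elim: k S c a p => //= k IH S c a p; rewrite IH coefCM. Qed.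

(* A letter of type 0, 1, 2 labels positions i with |pi_i| < i, = i, > i.  The
   sum of the variables of type 0. *)
Fixpoint dvars (s : seq nat) (S : comNzRingType) : tpoly (size s) S :=
  match s return tpoly (size s) S with
  | [::] => 0
  | ty :: s' => (if ty == 0%N then tpolyC (size s') {poly S} 'X else 0)
                + dvars s' {poly S}
  end.

(* In the row of a letter of type 0 (resp. 2), only the last (resp. first) column
   cannot hold that letter, whose variable is X. *)
Definition row_poly (A : comNzRingType) (ty c : nat) (X L : A) : A :=
  if ty == 1%N then L ^+ c else if c is c'.+1 then L ^+ c' * (L - X) else 1.

(* e stands for the sum of the variables of type 2 of the preceding letters. *)
Fixpoint row_prod (s c : seq nat) (S : comNzRingType) (e : S) :
    tpoly (size s) S :=
  match s return tpoly (size s) S with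
  | [::] => 1
  | ty :: s' =>
    row_poly ty (head 0%N c) (tpolyC (size s') {poly S} 'X)
      (tpolyC (size s') {poly S} (e%:P + 'X) + dvars s' {poly S})
    * row_prod s' (behead c) (if (1 < ty)%N then e%:P + 'X else e%:P)
  end.

Section LetterCount.
Variable V : zmodType.
Implicit Type n : nat -> V.

(** For type 0, no column of the row being excluded: [i] columns of the row hold this letter or a
    later one, the others being left to preceding letters of type 2. Among these [i] and the [k]
    owed columns, [c] hold the letter, and k + i - c are still owed. *)
Definition drop_count n (c k : nat) : V :=
  \sum_(i < c.+1) n (k + i - c)%N *+ ('C(c, i) * 'C(k + i, c)).

(** For type 2, no column of the row being excluded: [i] columns of the row are owed to later
    letters; k + c places remain for this letter and the preceding ones of type 2, and [c] of them
    hold this letter. *)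
Definition exc_count n (c k : nat) : V :=
  (\sum_(i < c.+1) n (k + i)%N *+ 'C(c, i)) *+ 'C(k + c, c).

(** Takes the excluded column into account: the cases where it holds the letter are those of a row
    with one column and one letter less. *)
Definition strict (F : nat -> V) (c : nat) : V :=
  if c is c'.+1 then F c - F c' else F 0%N.

Definition letter_count (ty : nat) n (c k : nat) : V :=
  if ty == 0%N then strict (fun c => drop_count n c k) c
  else if ty == 1%N then n k
  else strict (fun c => exc_count n c k) c.

End LetterCount.

(* The number of words of content c on the alphabet s, after k additional columns
   that only hold letters of type 0 and whose own letter is of type 2: see
   tcoef_row_prod. *)
Fixpoint word_count (s c : seq nat) (k : nat) : int :=
  if s is ty :: s' then
    letter_count ty (word_count s' (behead c)) (head 0%N c) k
  else (k == 0)%:R.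

Lemma coef_exprCDX (S : comNzRingType) (e : S) m a :
  ((e%:P + 'X) ^+ m)`_a = e ^+ (m - a) *+ 'C(m, a).
Proof.
rewrite exprDn (eq_bigr (fun i : 'I_m.+1 =>
  (e ^+ (m - i) *+ 'C(m, i)) *: 'X^i)).
  rewrite -(poly_def m.+1 (fun i => e ^+ (m - i) *+ 'C(m, i))) coef_poly.
  case: ltnP => // ma.
  by rewrite bin_small // mulr0n.
by move=> i _; rewrite -polyC_exp mul_polyC scalerMnl.
Qed.

Section RowCoef.
Variables (S : comNzRingType) (s c : seq nat).
Let X := tpolyC (size s) {poly S} 'X.
Let D := dvars s {poly S}.
Variable n : nat -> int.
(** The induction hypothesis of [tcoef_row_prod], for the letters after the current one. It is
    needed for polynomials [e], since a letter of type 2 adds its variable to [e]. *)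
Hypothesis coefD : forall j (e : {poly S}),
  tcoef c (D ^+ j * row_prod s c e) = e ^+ j *~ n j.

Lemma tcoef_row (e : {poly S}) k a :
  tcoef c (D ^+ k * (tpolyC (size s) {poly S} e + D) ^+ a * row_prod s c e)
  = e ^+ (k + a) *~ \sum_(i < a.+1) n (k + i)%N *+ 'C(a, i).
Proof.
rewrite exprDn mulr_sumr mulr_suml tcoef_sum mulrz_sumr.
apply: eq_bigr => i _.
rewrite -rmorphXn mulrnAr mulrnAl mulrCA -!mulrA tcoefMn tcoefCM mulrA.
rewrite -exprD coefD mulrzAr -exprD [(_ - _ + _)%N]addnCA subnK -1?ltnS //.
by rewrite -[in RHS]mulr_natr natz mulrzA -pmulrn.
Qed.

Lemma tcoef_row2 (e : S) k a :
  (tcoef c (D ^+ k * (tpolyC (size s) {poly S} (e%:P + 'X) + D) ^+ a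
            * row_prod s c (e%:P + 'X)))`_a = e ^+ k *~ exc_count n a k.
Proof.
rewrite tcoef_row coefMrz coef_exprCDX addnK /exc_count.
by rewrite -[X in _ = _ *~ X]mulr_natl natz mulrzA -pmulrn.
Qed.

Lemma tcoef_row0 (e : S) k a :
  (tcoef c ((X + D) ^+ k * (tpolyC (size s) {poly S} (e%:P + 'X) + D) ^+ a
            * row_prod s c e%:P))`_a = e ^+ k *~ drop_count n a k.
Proof.
(* Choosing X in [j] of the [m] factors leaves D^(m - j), to which [coefD] applies. *)
have XD m j : (tcoef c ((X + D) ^+ m * row_prod s c e%:P))`_j
    = e ^+ (m - j) *~ n (m - j)%N *+ 'C(m, j).
  rewrite exprDn mulr_suml tcoef_sum coef_sum.
  pose F i := (e ^+ i *~ n i *+ 'C(m, i)) *+ (m - i == j)%N.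
  rewrite (eq_bigr (fun i : 'I_m.+1 => F i)) => [|i _]; last first.
    rewrite -rmorphXn mulrnAl -mulrA tcoefMn tcoefCM coefD coefMn.
    rewrite mulrzAr coefMrz -polyC_exp mulrC coefCM coefXn.
    rewrite eq_sym /F; case: eqP => _; rewrite ?mulr1 ?mulr1n //.
    by rewrite mulr0 mul0rz mul0rn mulr0n.
  have [jm|mj] := leqP j m; last first.
    rewrite bin_small // mulr0n big1 // => i _; rewrite /F.
    by have -> : (m - i == j)%N = false by lia.
  have mj : (m - j < m.+1)%N by lia.
  rewrite (bigD1 (Ordinal mj)) //= big1 ?addr0 => [|i ne]; rewrite /F.
    by rewrite subKn // eqxx mulr1n bin_sub.
  rewrite (_ : (m - i == j)%N = false) //; apply/eqP => h.
  by case/eqP: ne; apply: val_inj => /=; have := ltn_ord i; lia.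
rewrite rmorphD /= -addrA [(tpolyC _ _ e%:P + _) ^+ a]exprDn.
rewrite mulr_sumr mulr_suml tcoef_sum coef_sum.
rewrite mulrz_sumr; apply: eq_bigr => i _.
rewrite -rmorphXn mulrnAr mulrnAl mulrCA -!mulrA tcoefMn tcoefCM mulrA.
rewrite -exprD coefMn -polyC_exp coefCM XD mulrnAr -mulrnA.
have [ak|ka] := leqP a (k + i); last first.
  by rewrite bin_small // !mul0n muln0 !mulr0n mulr0z.
rewrite mulrzAr -exprD (_ : (a - i + (k + i - a) = k)%N); last first.
  by have := ltn_ord i; lia.
by rewrite -[in RHS]mulr_natr natz mulrzA -pmulrn mulnC.
Qed.

Lemma tcoef_row1 (e : S) k a :
  (tcoef c (D ^+ k * (tpolyC (size s) {poly S} (e%:P + 'X) + D) ^+ a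
            * row_prod s c e%:P))`_a = e ^+ k *~ n k.
Proof.
rewrite rmorphD /= addrAC exprDn mulr_sumr mulr_suml tcoef_sum coef_sum.
rewrite big_ord_recr big1 => [|i _] /=; last first.
  rewrite -rmorphXn mulrnAr mulrnAl mulrA mulrAC tcoefMn mulrC tcoefCM.
  rewrite tcoef_row -polyC_exp coefMn mulrzAr coefMrz coefMC coefXn.
  by rewrite (gtn_eqF (ltn_ord i)) mul0r mul0rz mul0rn.
rewrite add0r subnn expr0 mul1r binn mulr1n mulrAC -rmorphXn mulrC tcoefCM.
by rewrite coefD mulrzAr coefMrz -polyC_exp coefMC coefXn eqxx mul1r.
Qed.

End RowCoef.

Lemma tcoef_strict k (S : comNzRingType) c ty (P L Q : tpoly k {poly S})
    (z : S) (F : nat -> int) a : ty != 1%N ->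
  (forall b, (tcoef c (P * L ^+ b * Q))`_b = z *~ F b) ->
  (tcoef c (P * (row_poly ty a (tpolyC k {poly S} 'X) L * Q)))`_a
  = z *~ strict F a.
Proof.
rewrite /row_poly => /negbTE -> H; case: a => [|a] /=.
  by rewrite -H expr0 mulr1 mul1r.
rewrite mulrBr mulrBl mulrBr tcoefB coefB mulrA -exprSr mulrA H.
rewrite -!mulrA [L ^+ a * _]mulrCA [P * _]mulrCA tcoefCM coefXM /= mulrA H.
by rewrite mulrzBr.
Qed.

(** By homogeneity: there are k + |c| linear factors and the monomial uses |c| of them, so that e^k
    is left, up to an integer. This integer is computed by removing the letters one after the
    other. *)
Lemma tcoef_row_prod (s c : seq nat) (S : comNzRingType) (e : S) k :
  size c = size s ->
  tcoef c (dvars s S ^+ k * row_prod s c e) = e ^+ k *~ word_count s c k.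
Proof.
elim: s c S e k => [|ty s IH] [|a c] //= S e k.
  by rewrite mulr1; case: k => [|k]; rewrite ?expr0 // exprS mul0r mulr0z.
move=> [sc]; have H j (e' : {poly S}) := IH c {poly S} e' j sc.
have r0 := tcoef_row0 H e k; have r1 := tcoef_row1 H e k.
have r2 := tcoef_row2 H e k.
case: ty => [|[|ty]] /=.
- exact: tcoef_strict.
- by rewrite add0r mulrA r1.
- by rewrite add0r; exact: tcoef_strict.
Qed.


(* Whether the column a can hold a letter whose row is [lo, hi). *)
Definition allowed (ty lo hi a : nat) : bool :=
  if ty == 0%N then (a < lo)%N || (a.+1 < hi)%N
  else if ty == 1%N then (lo <= a < hi)%N
  else (hi <= a)%N || (lo < a)%N.

Fixpoint tvar (k : nat) (S : comNzRingType) (i : nat) : tpoly k S :=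
  match k return tpoly k S with
  | 0 => 0
  | k'.+1 => if i is i'.+1 then tvar k' {poly S} i' else tpolyC k' {poly S} 'X
  end.

(** The linear form attached to the column [a], when the row of the first letter of [s] starts at
    [o]. *)
Fixpoint col_sum (s c : seq nat) (o a : nat) (S : comNzRingType) :
    tpoly (size s) S :=
  match s return tpoly (size s) S with
  | [::] => 0
  | ty :: s' => let hi := (o + head 0 c)%N in
     (if allowed ty o hi a then tpolyC (size s') {poly S} 'X else 0)
     + col_sum s' (behead c) hi a {poly S}
  end.

Lemma col_sumE s c o a (S : comNzRingType) : size c = size s ->
  col_sum s c o a S =
  \sum_(B < size s | allowed (nth 0%N s B) (o + sumn (take B c))
                       (o + sumn (take B.+1 c)) a) tvar (size s) S B.
Proof.
elim: s c o S => [|ty s IH] [|m c] o S //=; first by rewrite big_ord0.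
move=> [sc]; rewrite big_mkcond big_ord_recl /= take0 /= !addn0; congr (_ + _).
rewrite IH // big_mkcond; apply: eq_bigr => i _ /=.
by rewrite !addnA.
Qed.

Lemma col_sum_lt s c o a (S : comNzRingType) : (a < o)%N ->
  col_sum s c o a S = dvars s S.
Proof.
elim: s c o S => //= ty s IH c o S ao; rewrite IH; last by lia.
congr (_ + _); rewrite /allowed; case: ty => [|[|ty]] /=.
- by rewrite ao.
- by rewrite leqNgt ao.
- by rewrite (_ : _ || _ = false) //; lia.
Qed.

(** Columns after the first row can hold the first letter if and only if its type is 2, whence the
    change of [e]. Columns in the first row can hold, among the later letters, exactly those of type
    0. *)
Lemma row_prodE s c o (S : comNzRingType) (e : S) : size c = size s ->
  \prod_(o <= a < o + sumn c) (tpolyC (size s) S e + col_sum s c o a S)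
  = row_prod s c e.
Proof.
elim: s c o S e => [|ty s IH] [|m c] o S e //=.
  by move=> _; rewrite addn0 big_geq.
move=> [sc]; rewrite addnA (@big_cat_nat _ _ _ (o + m)) ?leq_addr //=.
set C := tpolyC (size s) {poly S}; congr (_ * _); last first.
  rewrite -(IH _ (o + m)%N) //; apply: eq_big_nat => a /andP[oa _].
  rewrite addrA; congr (_ + _); rewrite /allowed; case: ty => [|[|ty]] /=.
  - by rewrite (_ : _ || _ = false) ?addr0 //; lia.
  - by rewrite (_ : _ && _ = false) ?addr0 //; lia.
  - by rewrite oa /= rmorphD.
have -> : \prod_(o <= a < o + m) (C e%:P
      + ((if allowed ty o (o + m) a then C 'X else 0)
         + col_sum s c (o + m) a _))
   = \prod_(o <= a < o + m) (C e%:P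
      + ((if allowed ty o (o + m) a then C 'X else 0) + dvars s _)).
  by apply: eq_big_nat => a /andP[_ am]; rewrite col_sum_lt.
have LX : C (e%:P + 'X) + dvars s _ - C 'X = C e%:P + (0 + dvars s _).
  by rewrite rmorphD /= add0r addrAC addrK.
have constL (b d : nat) :
    (forall a, (b <= a < b + d)%N -> allowed ty o (o + m) a) ->
    \prod_(b <= a < b + d) (C e%:P
      + ((if allowed ty o (o + m) a then C 'X else 0) + dvars s _))
    = (C (e%:P + 'X) + dvars s _) ^+ d.
  move=> H; rewrite -[d in RHS](addKn b) -prodr_const_nat.
  by apply: eq_big_nat => a /H ->; rewrite rmorphD addrA.
rewrite /row_poly; case: ty => [|[|ty]] /= in constL *.
- case: m constL => [|m] constL; first by rewrite addn0 big_geq.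
  rewrite addnS big_nat_recr ?leq_addr //= -addnS constL; last first.
    by move=> a; rewrite /allowed /=; lia.
  by rewrite LX /allowed /= (_ : _ || _ = false) //; lia.
- by apply: constL => a; rewrite /allowed.
- case: m constL => [|m] constL; first by rewrite addn0 big_geq.
  rewrite -addSnnS in constL *; rewrite big_ltn ?leq_addr // constL; last first.
    by move=> a; rewrite /allowed /=; lia.
  by rewrite mulrC LX /allowed /= (_ : _ || _ = false) //; lia.
Qed.

Lemma tcoef_monomial k (S : comNzRingType) c (m : nat -> nat) : size c = k ->
  tcoef c (\prod_(B < k) tvar k S B ^+ m B) =
  [forall B : 'I_k, m B == nth 0%N c B]%:R.
Proof.
elim: k S c m => [|k IH] S [|i c] //= m.
  move=> _; rewrite big_ord0.
  by case: forallP => // -[[]].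
move=> [sc]; rewrite big_ord_recl /= -rmorphXn tcoefCM (IH _ _ (m \o succn)) //.
have -> : [forall B : 'I_k.+1, m B == nth 0%N (i :: c) B]
    = (m 0%N == i) && [forall B : 'I_k, (m \o succn) B == nth 0%N c B].
  apply/forallP/andP => [H|[H0 /forallP H] B].
    by split; [exact: (H ord0) | apply/forallP => B; exact: (H (lift ord0 B))].
  by case: (unliftP ord0 B) => [j|] -> //; exact: (H j).
rewrite mulr_natr coefMn coefXn eq_sym.
by case: eqP => _ /=; [rewrite -mulr_natr mul1r | rewrite mul0rn].
Qed.

Definition word_content k n (v : {ffun 'I_n -> 'I_k}) (B : 'I_k) : nat :=
  #|[set a | v a == B]|.

Definition allowed_word K n s c (v : {ffun 'I_n -> 'I_K}) : bool :=
  [forall a : 'I_n, allowed (nth 0%N s (v a)) (sumn (take (v a) c))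
     (sumn (take (v a).+1 c)) a].

(** When the product of the linear forms of the columns is expanded, choosing a variable in each
    column amounts to choosing an allowed word, and the monomial obtained is its content. *)
Lemma card_allowed_word K s n c (S : comNzRingType) :
  size s = K -> size c = K -> sumn c = n ->
  (\sum_(v : {ffun 'I_n -> 'I_K} |
      [forall B, word_content v B == nth 0%N c B] && allowed_word s c v) 1)
  = (word_count s c 0)%:~R :> S.
Proof.
case: K / => sc cn; rewrite -[RHS]mul1r mulrzr -(expr0 0) -tcoef_row_prod //.
rewrite expr0 mul1r -(row_prodE 0) // cn add0n rmorph0.
rewrite big_mkord (eq_bigr (fun a : 'I_n => \sum_(B < size s)
   (if allowed (nth 0%N s B) (sumn (take B c)) (sumn (take B.+1 c)) a
    then tvar (size s) S B else 0))) => [|a _]; last first.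
  by rewrite add0r col_sumE // big_mkcond.
rewrite bigA_distr_bigA tcoef_sum /= big_mkcond /=; apply: eq_bigr => v _.
have [aw|] := boolP (allowed_word s c v); last first.
  rewrite andbF negb_forall => /existsP[a na].
  by rewrite (bigD1 a) //= (negbTE na) mul0r tcoef0.
rewrite (eq_bigr (fun a => tvar (size s) S (v a))) => [|a _]; last first.
  by rewrite (forallP aw a).
rewrite (partition_big v predT) //= andbT.
rewrite (eq_bigr (fun B : 'I__ => tvar (size s) S B
    ^+ #|[set a | v a == B :> nat]|)) => [|B _]; last first.
  by rewrite -prodr_const; apply: eq_big => [a|a /eqP ->] //; rewrite inE.
rewrite (tcoef_monomial _ (fun b => #|[set a | v a == b :> nat]|)) //.
by case: ifP.
Qed.


(** * Generating functions of words *)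

(** [letter_count] is an integer combination of values of [n], hence compatible with additive maps
    and, below, with sums. *)
Lemma letter_count_raddf (V V' : zmodType) (h : {additive V -> V'})
    ty (n : nat -> V) c k :
  h (letter_count ty n c k) = letter_count ty (fun j => h (n j)) c k.
Proof.
rewrite /letter_count; case: eqP => _; [|case: eqP => _ //].
  have hd b : h (drop_count n b k) = drop_count (fun j => h (n j)) b k.
    by rewrite raddf_sum; apply: eq_bigr => i _; rewrite raddfMn.
  by case: c => [|c]; rewrite /= ?raddfB !hd.
have he b : h (exc_count n b k) = exc_count (fun j => h (n j)) b k.
  rewrite raddfMn raddf_sum; congr (_ *+ _).
  by apply: eq_bigr => i _; rewrite raddfMn.
by case: c => [|c]; rewrite /= ?raddfB !he.
Qed.

Lemma letter_count_sum (V : zmodType) (I : Type) (r : seq I) (P : pred I)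
    ty (n : I -> nat -> V) c k :
  \sum_(i <- r | P i) letter_count ty (n i) c k
  = letter_count ty (fun j => \sum_(i <- r | P i) n i j) c k.
Proof.
rewrite /letter_count; case: eqP => _; [|case: eqP => _ //].
  have hd b : \sum_(i <- r | P i) drop_count (n i) b k
      = drop_count (fun j => \sum_(i <- r | P i) n i j) b k.
    by rewrite exchange_big; apply: eq_bigr => i _; rewrite sumrMnl.
  by case: c => [|c]; rewrite /= ?sumrB !hd.
have he b : \sum_(i <- r | P i) exc_count (n i) b k
    = exc_count (fun j => \sum_(i <- r | P i) n i j) b k.
  rewrite sumrMnl exchange_big; congr (_ *+ _).
  by apply: eq_bigr => i _; rewrite sumrMnl.
by case: c => [|c]; rewrite /= ?sumrB !he.
Qed.

Lemma eq_letter_count (V : zmodType) ty (n n' : nat -> V) c k :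
  n =1 n' -> letter_count ty n c k = letter_count ty n' c k.
Proof.
move=> nn; rewrite /letter_count; case: eqP => _; [|case: eqP => _ //].
  have hd b : drop_count n b k = drop_count n' b k.
    by apply: eq_bigr => i _; rewrite nn.
  by case: c => [|c]; rewrite /= !hd.
have he b : exc_count n b k = exc_count n' b k.
  by congr (_ *+ _); apply: eq_bigr => i _; rewrite nn.
by case: c => [|c]; rewrite /= !he.
Qed.

Section WordSeries.
Variable R : comUnitRingType.
Implicit Types s : seq (nat * R).

Definition types s := [seq l.1 | l <- s].

Definition word_weight s (c : seq nat) : R :=
  \prod_(i < size s) (nth 0 [seq l.2 | l <- s] i) ^+ nth 0%N c i.

(* L bounds the size of the rows; it is immaterial as soon as n < L. *)
Definition word_sum L s k n : R :=
  \sum_(c : (size s).-tuple 'I_L | sumn (map val c) == n)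
     word_weight s (map val c) *~ word_count (types s) (map val c) k.

Lemma word_sum_cons L ty w s k n : (n < L)%N ->
  word_sum L ((ty, w) :: s) k n =
  \sum_(c < n.+1)
     w ^+ c * letter_count ty (fun j => word_sum L s j (n - c)%N) c k.
Proof.
move=> nL; rewrite /word_sum big_tuple_cons /=.
rewrite (big_ord_widen L (fun c => w ^+ c * letter_count ty
  (fun j => word_sum L s j (n - c)%N) c k) nL) [RHS]big_mkcond.
apply: eq_bigr => c _; case: ifP => cn; last first.
  rewrite big_pred0 // => t; apply/negbTE; apply/negP => /eqP h.
  by move: cn; rewrite -h ltnS leq_addr.
rewrite -letter_count_sum mulr_sumr; apply: eq_big => [t|t _] /=.
  by rewrite -[in LHS](subnKC (_ : c <= n)%N) ?eqn_add2l -1?ltnS.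
rewrite {1}/word_weight big_ord_recl /= -mulrzAr; congr (_ * _).
exact: (letter_count_raddf (intmul (word_weight s (map val t)))).
Qed.


(* The generating function of word_count (types s) _ k is alpha ^+ k * phi s, and
   wser s = 1 / (1 + alpha): in terms of wser, adding a letter is affine. *)
Fixpoint wser s : fps R :=
  if s is (ty, w) :: s' then
    if ty == 0%N then (1 - fpsC w * fpsX) * wser s'
    else if ty == 1%N then wser s'
    else (wser s' - fpsC w * fpsX) / (1 - fpsC w * fpsX)
  else 1.

Fixpoint phi s : fps R :=
  if s is (ty, w) :: s' then
    if ty == 0%N then phi s'
    else if ty == 1%N then phi s' / (1 - fpsC w * fpsX)
    else phi s' * wser s' / wser s
  else 1.

Lemma wser_coef0 s : fps_coef (wser s) 0 = 1.
Proof.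
elim: s => [|[ty w] s IH] /=; first by rewrite fps_coef1.
case: ifP => _; last case: ifP => // _; rewrite fps_coefM0 fps_coefD fps_coefN.
  by rewrite fps_coefCM fps_coef1 IH mulr0 subr0 mulr1.
by rewrite fps_coefCM fps_coef_geom expr0 IH mulr0 subr0 mulr1.
Qed.

Lemma wser_unit s : wser s \is a GRing.unit.
Proof. exact/fps_unit1/wser_coef0. Qed.

Let gser s k : fps R := ((wser s)^-1 - 1) ^+ k * phi s.

(** Both sides are the multinomial coefficient (k+i)! / (i! (c-i)! (k+i-c)!), or vanish if c > k +
    i. *)
Lemma bin_drop c k i : (i <= c)%N ->
  ('C(c, i) * 'C(k + i, c) = 'C(k, c - i) * 'C(k + i, i))%N.
Proof.
move=> ic; have [ck|kc] := leqP c (k + i); last first.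
  by rewrite (@bin_small (k + i) c) // (@bin_small k (c - i)) ?muln0 //; lia.
have ck' : (c - i <= k)%N by lia.
apply/eqP; rewrite -(eqn_pmul2r (fact_gt0 (k + i - c))).
rewrite -(eqn_pmul2r (fact_gt0 c)) -(eqn_pmul2r (fact_gt0 i)).
rewrite -(eqn_pmul2r (fact_gt0 (c - i))).
have e1 := bin_fact ic; have e2 := bin_fact ck; have e3 := bin_fact ck'.
have e4 := bin_fact (leq_addl k i); rewrite addnK in e4.
have -> : (k + i - c = k - (c - i))%N by lia.
rewrite (_ : k + i - c = k - (c - i))%N in e2; last by lia.
apply/eqP.
transitivity ((k + i)`! * c`!)%N; first by rewrite -e2 -e1; ring.
by rewrite -e4 -e3; ring.
Qed.

(** The outer variable records [c] until [fps_diag] identifies it with the inner one. With x = w z,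
    alpha becomes (alpha + x) / (1 - x) for type 0 and alpha / (1 - (1 + alpha) x) for type 2. *)
Lemma letter_series ty w s k :
  fps_diag (Fps (fun c => fpsC (w ^+ c) * letter_count ty (gser s) c k))
  = gser ((ty, w) :: s) k.
Proof.
set F := Fps _.
set y : fps (fps R) := fpsC (fpsC w) * fpsX.
have yE : fps_diag y = fpsC w * fpsX by rewrite fps_diagCM fps_diagX.
have y1 : fps_diag (1 - y)^-1 = (1 - fpsC w * fpsX)^-1.
  by rewrite rmorphV ?fps_unit_1subX // rmorphB rmorph1 /= yE.
(* Multiplying by 1 - y takes the differences that occur in [strict]. *)
have strictE (G : fps (fps R)) (f : nat -> fps R) :
    (forall c, fps_coef G c = fpsC (w ^+ c) * f c) ->
    (1 - y) * G = Fps (fun c => fpsC (w ^+ c) * strict f c).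
  move=> GE; apply: fpsP => c; rewrite mulrBl mul1r fps_coefD fps_coefN -mulrA.
  rewrite fps_coefCM fps_coefXM GE; case: c => [|c].
    by rewrite mulr0 subr0.
  by rewrite GE mulrA -rmorphM -exprS /= -mulrBr.
have U1 : 1 - fpsC w * fpsX \is a GRing.unit := fps_unit_1subX _.
have UW := wser_unit s.
have UW' := wser_unit ((ty, w) :: s).
move: UW' (erefl F); rewrite {2}/F /gser /= /letter_count.
set x := fpsC w * fpsX in yE y1 U1 *; set a := (wser s)^-1 - 1.
have d1y : fps_diag (1 - y) = 1 - x by rewrite rmorphB rmorph1 /= yE.
have i1 : (1 - x) * (1 - x)^-1 = 1 by rewrite divrr.
have W1 : wser s * (wser s)^-1 = 1 by rewrite divrr.
case: (eqVneq ty 0%N) => [ty0|nty0]; last case: (eqVneq ty 1%N) => [ty1|nty1].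
- move=> UW'; rewrite -(@strictE (fpsC (phi s) * ((fpsC a + y) ^+ k
      * (1 - y)^-1 ^+ k.+1))) => [->|c].
    rewrite fps_diagM fps_diagCM fps_diagM !fps_diagXn fps_diagD fps_diagC.
    rewrite y1 yE d1y.
    have -> : ((1 - x) * wser s)^-1 - 1 = (a + x) * (1 - x)^-1.
      rewrite invrM // /a -[X in _ - X]i1; ring.
    rewrite exprMn exprS.
    transitivity ((1 - x) * (1 - x)^-1 *
      (phi s * ((a + x) ^+ k * (1 - x)^-1 ^+ k))); first by ring.
    by rewrite i1 mul1r mulrC.
  (* By [bin_drop], [drop_count] is a convolution of the coefficients of (a + y)^k and (1 -
     y)^-(k+1). *)
  rewrite fps_coefCM [_ ^+ k * _]mulrC fps_coefM /drop_count !mulr_sumr.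
  apply: eq_bigr => i _; have ic : (i <= c)%N by rewrite -ltnS.
  rewrite fps_coef_negbin fps_coef_bin bin_drop //.
  rewrite (_ : k + i - c = k - (c - i))%N; last by lia.
  have -> : fpsC (w ^+ c) = fpsC w ^+ i * fpsC w ^+ (c - i).
    by rewrite -exprD subnKC // rmorphXn.
  rewrite mulrnA !(mulrnAl, mulrnAr).
  by congr (_ *+ _ *+ _); ring.
- move=> UW' ->.
  have -> : Fps (fun c => fpsC (w ^+ c) * (a ^+ k * phi s))
      = fpsC (a ^+ k * phi s) * (1 - y)^-1.
    by apply: fpsP => c; rewrite fps_coefCM fps_coef_geom -rmorphXn [RHS]mulrC.
  by rewrite rmorphM /= fps_diagC y1 mulrA.
- move=> UW'.
  have Ux : wser s - x \is a GRing.unit.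
    by move: UW'; rewrite unitrMl ?unitrV.
  set b := (1 - fpsC w * (wser s)^-1 * fpsX)^-1.
  have bE : b = wser s / (wser s - x).
    rewrite /b; have -> : 1 - fpsC w * (wser s)^-1 * fpsX
      = (wser s)^-1 * (wser s - x).
      rewrite /x -W1; ring.
    by rewrite invrM ?unitrV // invrK mulrC.
  rewrite -(@strictE (fpsC (a ^+ k * phi s)
      * (1 - fpsC (fpsC w * (wser s)^-1) * fpsX)^-1 ^+ k.+1)) => [->|c].
    rewrite fps_diagM fps_diagCM fps_diagXn d1y.
    have -> : fps_diag (1 - fpsC (fpsC w / wser s) * fpsX)^-1 = b.
      rewrite rmorphV ?fps_unit_1subX // rmorphB rmorph1 /=.
      by rewrite fps_diagCM fps_diagX.
    have -> : ((wser s - x) / (1 - x))^-1 = (1 - x) / (wser s - x).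
      by rewrite invrM ?unitrV // invrK.
    have i2 : (wser s - x) / (wser s - x) = 1 by rewrite divrr.
    have -> : (1 - x) / (wser s - x) - 1 = a * b.
      have aW : a * wser s = 1 - wser s by rewrite /a mulrBl mulVr // mul1r.
      rewrite bE mulrA aW -[X in _ - X]i2; ring.
    have -> : phi s * wser s * ((1 - x) / (wser s - x)) = (1 - x) * phi s * b.
      by rewrite bE; ring.
    rewrite exprMn exprS; ring.
  rewrite fps_coefCM fps_coef_negbin /exc_count mulrnAr mulrnAr; congr (_ *+ _).
  have -> : (wser s)^-1 = 1 + a by rewrite /a addrC subrK.
  rewrite exprMn rmorphXn mulrCA; congr (_ * _).
  rewrite [(1 + a) ^+ c]exprDn mulr_sumr; apply: eq_bigr => i _.
  by rewrite expr1n mul1r mulrnAr exprD mulrAC.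
Qed.

Lemma word_sumE L s k n : (n < L)%N ->
  word_sum L s k n = fps_coef (((wser s)^-1 - 1) ^+ k * phi s) n.
Proof.
elim: s k n => [|[ty w] s IH] k n nL.
  rewrite /word_sum /= invr1 subrr mulr1 (eq_bigl (fun=> 0%N == n)); last first.
    by move=> c; rewrite tuple0.
  rewrite big_mkcond (big_pred1 [tuple]) => [|c]; last first.
    by apply/esym/eqP; exact: tuple0.
  rewrite /word_weight big_ord0 /= expr0n fps_coef_natr.
  by case: (k == 0%N); case: n {nL}.
rewrite word_sum_cons // -[_ * _]/(gser ((ty, w) :: s) k) -letter_series.
rewrite fps_coef_diag; apply: eq_bigr => c _.
rewrite -[fps_coef (Fps _) c]/(_ * _) fps_coefCM; congr (_ * _).
rewrite [RHS](letter_count_raddf (fps_coefr (n - c) : {additive _ -> _})).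
apply: eq_letter_count => j; apply: IH.
by apply: leq_ltn_trans nL; apply: leq_subr.
Qed.

End WordSeries.


(** * Standardization of words *)

Lemma card_ord_interval n (x y : nat) :
  (#|[set b : 'I_n | (x <= b < y)%N]| <= y - x)%N.
Proof.
rewrite cardE -(size_map val) -[X in (_ <= X)%N](size_iota x).
apply: uniq_leq_size => [|b]; first by rewrite (map_inj_uniq val_inj) enum_uniq.
by case/mapP => i; rewrite mem_enum inE mem_iota => ? -> /=; lia.
Qed.

Lemma ltn_lex (n a b i j : nat) : (i < n)%N -> (j < n)%N ->
  (a * n + i < b * n + j)%N = (a < b)%N || (a == b) && (i < j)%N.
Proof.
move=> iN jN; have [ab|ba|->] := ltngtP a b.
- have h : (n + a * n <= b * n)%N by rewrite -mulSn leq_mul2r ab orbT.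
  apply: leq_trans (leq_addr _ _); apply: leq_trans h.
  by rewrite addnC ltn_add2r.
- have h : (n + b * n <= a * n)%N by rewrite -mulSn leq_mul2r ba orbT.
  apply/negbTE; rewrite -leqNgt; apply: leq_trans (leq_addr _ _).
  by apply: leq_trans h; rewrite addnC leq_add2r ltnW.
- by rewrite ltn_add2l.
Qed.

Section Standardization.
Variables K n : nat.
Implicit Types (v : {ffun 'I_n -> 'I_K}) (a b : 'I_n).

(** Encodes the order on columns by letter, then from left to right. *)
Definition word_key v a : nat := (v a * n + a)%N.

Lemma word_key_inj v : injective (word_key v).
Proof.
move=> a b; rewrite /word_key => ab; apply: val_inj => /=.
have := ltn_lex (v a) (v b) (ltn_ord a) (ltn_ord b).
have := ltn_lex (v b) (v a) (ltn_ord b) (ltn_ord a).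
by rewrite ab !ltnn; case: (ltngtP (v a) (v b)) => //=; case: ltngtP.
Qed.

Definition word_rank v a : nat := #|[set b | (word_key v b < word_key v a)%N]|.

Lemma word_rank_mono v a b :
  (word_rank v a < word_rank v b)%N = (word_key v a < word_key v b)%N.
Proof.
have mono x y : (word_key v x < word_key v y)%N ->
    (word_rank v x < word_rank v y)%N.
  move=> xy; apply: proper_card; apply/properP; split.
    by apply/subsetP => z; rewrite !inE => /ltn_trans; apply.
  by exists x; rewrite !inE ?xy ?ltnn.
apply/idP/idP => [|/mono //]; rewrite !ltnNge; apply: contra.
rewrite leq_eqVlt => /orP[/eqP/word_key_inj -> //|/mono /ltnW //].
Qed.

Lemma word_rank_lt v a : (word_rank v a < n)%N.
Proof.
rewrite -[X in (_ < X)%N]card_ord -cardsT; apply: proper_card.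
by apply/properP; split; [exact: subsetT | exists a; rewrite !inE ?ltnn].
Qed.

Definition word_pos v a : 'I_n := Ordinal (word_rank_lt v a).

Lemma word_pos_inj v : injective (word_pos v).
Proof.
move=> a b [] ab; apply: (@word_key_inj v).
by case: (ltngtP (word_key v a) (word_key v b)) => //;
  rewrite -word_rank_mono ab ltnn.
Qed.

(** The stable sort of [v] puts the column [std v i] at the position [i]; [word_pos v] is the
    inverse map. *)
Definition std v : {perm 'I_n} := (perm (@word_pos_inj v))^-1%g.

Lemma stdK v a : std v (word_pos v a) = a.
Proof. by rewrite -(permE (@word_pos_inj v)) permK. Qed.

Lemma word_posK v i : word_pos v (std v i) = i.
Proof. by rewrite -(permE (@word_pos_inj v)) permKV. Qed.

Lemma std_key_mono v (i j : 'I_n) :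
  (word_key v (std v i) < word_key v (std v j))%N = (i < j)%N.
Proof.
by rewrite -word_rank_mono -{2}[i](word_posK v) -{2}[j](word_posK v).
Qed.

(** The columns of smaller key than [sg i] are the images of the positions before [i], so that
    [sg i] has rank [i]. *)
Lemma std_unique v (sg : {perm 'I_n}) :
  (forall i j : 'I_n, (i < j)%N -> (word_key v (sg i) < word_key v (sg j))%N) ->
  std v = sg.
Proof.
move=> mono; apply/permP => i; rewrite -[sg i](stdK v); congr (std v _).
apply: val_inj; rewrite /= /word_rank -[LHS](card_ord i) -cardsT.
have wi : injective (widen_ord (ltnW (ltn_ord i))).
  by move=> x y /(congr1 val) /= xy; apply: val_inj.
rewrite -(card_imset _ wi) -(card_imset _ (@perm_inj _ sg)).
apply: eq_card => b; rewrite inE; apply/imsetP/idP => [[j /imsetP[x _ ->] ->]|].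
  by apply: mono => /=.
rewrite -[b](permKV sg) => lt; exists (sg^-1%g b) => //.
have ji : (sg^-1%g b < i)%N.
  rewrite ltnNge leq_eqVlt; apply/negP => /orP[/eqP/val_inj ij|/mono].
    by rewrite -ij ltnn in lt.
  by rewrite ltnNge ltnW.
by apply/imsetP; exists (Ordinal ji) => //; apply: val_inj.
Qed.

Definition cmp_type (value position : nat) : nat :=
  if (value < position)%N then 0 else if value == position then 1 else 2.

End Standardization.

Lemma sumn_take_content K n (v : {ffun 'I_n -> 'I_K}) c m :
  size c = K -> (forall B : 'I_K, word_content v B = nth 0%N c B) ->
  (m <= K)%N -> sumn (take m c) = #|[set b | (v b < m)%N]|.
Proof.
move=> sc cv; elim: m => [|m IH] mK.
  rewrite take0; apply/esym/eqP; rewrite cards_eq0.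
  by apply/eqP/setP => b; rewrite !inE.
rewrite (take_nth 0%N) ?sc // -cats1 sumn_cat /= addn0 IH; last exact: ltnW.
rewrite -(cv (Ordinal mK)) /word_content -cardsUI.
rewrite [X in (_ + #|pred_of_set X|)%N](_ : _ = set0) ?cards0 ?addn0.
  by apply: eq_card => b; rewrite !inE -val_eqE /= ltnS [RHS]leq_eqVlt orbC.
apply/setP => b; rewrite !inE -val_eqE /=.
apply/negbTE/negP => /andP[bm /eqP h].
by rewrite h ltnn in bm.
Qed.

(* Writing a_0 < a_1 < ... for the columns of v that hold a letter B, whose row is
   [lo, hi), the position of a_j is lo + j: so a_j < lo + j for all j as soon as
   the last a_j is smaller than hi - 1, and symmetrically for type 2. *)
Lemma allowed_wordE K s n c (v : {ffun 'I_n -> 'I_K}) :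
  all (fun ty => (ty < 3)%N) s -> size s = K -> size c = K ->
  (forall B : 'I_K, word_content v B = nth 0%N c B) ->
  allowed_word s c v = [forall a, nth 0%N s (v a) == cmp_type a (word_pos v a)].
Proof.
move=> s3 sK; subst K => sc cv.
set lo := fun B => sumn (take B c).
have loS (B : 'I_(size s)) : lo B.+1 = (lo B + word_content v B)%N.
  by rewrite /lo (take_nth 0%N) ?sc // -cats1 sumn_cat /= addn0 cv.
(* The numbers of columns before and after [a] that hold the same letter as [a]. *)
pose r a := #|[set b | (v b == v a) && (b < a)%N]|.
pose r' a := #|[set b | (v b == v a) && (a < b)%N]|.
have posE a : word_pos v a = (lo (v a) + r a)%N :> nat.
  rewrite /lo (sumn_take_content sc cv) ?(ltnW (ltn_ord _)) //=.
  rewrite /word_rank -cardsUI.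
  rewrite [X in _ = (_ + #|pred_of_set X|)%N](_ : _ = set0) ?cards0 ?addn0.
    apply: eq_card => b; rewrite !inE /word_key.
    by rewrite ltn_lex ?ltn_ord // val_eqE.
  apply/setP => b; rewrite !inE; apply/negbTE/negP => /and3P[bm /eqP h _].
  by rewrite h ltnn in bm.
have rr' a : (r a + r' a).+1 = word_content v (v a).
  rewrite /word_content (cardsD1 a) inE eqxx add1n; congr _.+1.
  rewrite -cardsUI [X in (_ + #|pred_of_set X|)%N](_ : _ = set0) ?cards0 ?addn0.
    apply: eq_card => b; rewrite !inE -andb_orr andbC.
    by rewrite -val_eqE neq_ltn.
  apply/setP => b; rewrite !inE.
  apply/negbTE/negP => /andP[/andP[_ h] /andP[_]].
  by rewrite ltnNge ltnW.
have card_le (A : {set 'I_n}) x y : (forall b, b \in A -> (x <= b < y)%N) ->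
    (#|A| <= y - x)%N.
  move=> H; apply: leq_trans (card_ord_interval n x y); apply: subset_leq_card.
  by apply/subsetP => b /H; rewrite inE.
have rP a x y : (forall b, v b = v a -> (b < a)%N -> (x <= b < y)%N) ->
    (r a <= y - x)%N.
  by move=> H; apply: card_le => b; rewrite inE => /andP[/eqP]; apply: H.
have rP' a x y : (forall b, v b = v a -> (a < b)%N -> (x <= b < y)%N) ->
    (r' a <= y - x)%N.
  by move=> H; apply: card_le => b; rewrite inE => /andP[/eqP]; apply: H.
apply/forallP/forallP => H a; move: (H a) (posE a) (loS (v a)) (rr' a);
  rewrite -/(lo (v a)) -/(lo (v a).+1) /allowed /cmp_type /=.
- have := mem_nth 0%N (_ : v a < size s)%N; move/(_ (ltn_ord _))/(allP s3).
  case E: (nth 0%N s (v a)) => [|[|[|//]]] _ /= Ha posa loE rE.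
  (* Type 0, with row [lo, hi): all columns of the letter are smaller than hi - 1, so at most hi - 2
     - a of them follow [a], and the position hi - 1 - r' of [a] exceeds [a]. *)
  + have Hb b : v b = v a -> (b.+1 < lo (v a).+1)%N.
      move=> vb; move: (H b).
      rewrite -/(lo (v b)) -/(lo (v b).+1) vb E /allowed /=.
      by have := rr' a; lia.
    have r'a : (r' a <= (lo (v a).+1).-1 - a.+1)%N.
      by apply: rP' => b vb ab; have := Hb b vb; lia.
    by have := Hb a erefl; rewrite (_ : (a < word_rank v a)%N) //; lia.
  (* Type 1: all columns of the letter lie in [lo, hi). As r + r' + 1 = hi - lo, the bounds on r and
     r' are equalities, and a = lo + r. *)
  + have Hb b : v b = v a -> (lo (v a) <= b < lo (v a).+1)%N.
      move=> vb; move: (H b).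
      by rewrite -/(lo (v b)) -/(lo (v b).+1) vb E /allowed /=.
    have ra : (r a <= a - lo (v a))%N.
      by apply: rP => b vb ba; have := Hb b vb; lia.
    have r'a : (r' a <= lo (v a).+1 - a.+1)%N.
      by apply: rP' => b vb ab; have := Hb b vb; lia.
    have e : nat_of_ord a = word_rank v a by lia.
    by rewrite -e ltnn eqxx.
  + have Hb b : v b = v a -> (lo (v a) < b)%N.
      move=> vb; move: (H b).
      rewrite -/(lo (v b)) -/(lo (v b).+1) vb E /allowed /=.
      by have := rr' a; lia.
    have ra : (r a <= a - (lo (v a)).+1)%N.
      by apply: rP => b vb ba; have := Hb b vb; lia.
    have := Hb a erefl => lta.
    rewrite (_ : (a < word_rank v a)%N = false); last by lia.
    by have -> : (nat_of_ord a == word_rank v a) = false by lia.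
- move=> /eqP -> posa loE rE; case: ltngtP => /= h; lia.
Qed.

Lemma size_types (R : comUnitRingType) (s : seq (nat * R)) :
  size (types s) = size s.
Proof. exact: size_map. Qed.

Definition good_word K n (s : seq nat) (v : {ffun 'I_n -> 'I_K}) : bool :=
  [forall a, nth 0%N s (v a) == cmp_type a (word_pos v a)].

(** Words are grouped by content. [phi] is the series for k = 0, when no column is owed. *)
Lemma good_word_sum (R : comUnitRingType) K n (s : seq (nat * R)) :
  size s = K -> all (fun ty => (ty < 3)%N) (types s) ->
  \sum_(v : {ffun 'I_n -> 'I_K} | good_word (types s) v)
     \prod_a nth 0 [seq l.2 | l <- s] (v a)
  = fps_coef (phi s) n.
Proof.
case: K / => s3; transitivity (word_sum n.+1 s 0 n); last first.
  by rewrite word_sumE // expr0 mul1r.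
have content_lt (v : {ffun 'I_n -> 'I_(size s)}) B :
    (word_content v B < n.+1)%N.
  by rewrite ltnS -[X in (_ <= X)%N]card_ord max_card.
pose content (v : {ffun 'I_n -> 'I_(size s)}) : (size s).-tuple 'I_n.+1 :=
  [tuple Ordinal (content_lt v B) | B < size s].
have szc v : size (map val (content v)) = size s.
  by rewrite size_map size_tuple.
have contentE v (B : 'I_(size s)) :
    word_content v B = nth 0%N (map val (content v)) B.
  rewrite (nth_map (Ordinal (content_lt v B))) ?size_tuple //.
  by rewrite -tnth_nth tnth_mktuple.
rewrite (partition_big content (fun c => sumn (map val c) == n)) => [|v _].
  apply: eq_bigr => c /eqP cn.
  rewrite -mulrzr -(@card_allowed_word (size s) (types s) n)
    ?size_types ?size_map ?size_tuple //.
  rewrite mulr_sumr; apply: eq_big => [v|v /andP[_ /eqP vc]].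
    have -> : [forall B, word_content v B == nth 0%N (map val c) B]
        = (content v == c).
      apply/forallP/eqP => [H|<- B]; last by apply/eqP/contentE.
      apply: eq_from_tnth => B; apply: val_inj; rewrite tnth_mktuple /=.
      by rewrite (eqP (H B)) (nth_map (tnth c B)) ?size_tuple // -tnth_nth.
    have [<-|_] := eqVneq (content v) c; rewrite ?andbF ?andbT //=.
    by rewrite (allowed_wordE s3 (size_types s) (szc v)); last exact: contentE.
  rewrite mulr1 /word_weight (partition_big v predT) //=; apply: eq_bigr => B _.
  rewrite -vc -contentE /word_content -prodr_const.
  by apply: eq_big => [a|a /eqP -> //]; rewrite inE.
have := sumn_take_content (szc v) (contentE v) (leqnn _).
rewrite take_oversize ?szc // => ->.
rewrite (_ : [set _ | _] = setT) ?cardsT ?card_ord //.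
by apply/setP => b; rewrite !inE ltn_ord.
Qed.


(** * Labels of colored permutations *)

Lemma desc_seqP (D : nat -> bool) l (s : seq nat) :
  reflect (forall i, (i < size s)%N ->
             (nth 0%N s i + D i <= nth 0%N (l :: s) i)%N) (desc_seq D l s).
Proof.
elim: s D l => [|a s IH] D l /=; first by apply: ReflectT.
apply: (iffP andP) => [[aD /IH H] [|i] //|H]; first exact: H.
by split; [exact: (H 0%N) | apply/IH => i; exact: (H i.+1)].
Qed.

Lemma ltn_mono_succ n (k : 'I_n -> nat) :
  (forall i j : 'I_n, i.+1 = j -> (k i < k j)%N) ->
  forall i j : 'I_n, (i < j)%N -> (k i < k j)%N.
Proof.
move=> H i j; move: {2}(j - i)%N (erefl (j - i)%N) => d.
elim: d i j => [|d IH] i j dE ij; first by lia.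
have i1 : (i.+1 < n)%N by apply: leq_ltn_trans (ltn_ord j).
have [e|ne] := eqVneq i.+1 j; first exact: H.
apply: ltn_trans (H i (Ordinal i1) erefl) _.
by apply: IH => /=; lia.
Qed.

Section Labels.
Variables N l n : nat.
Hypothesis N_gt0 : (0 < N)%N.

(* Labels are numbered in the order in which they occur along the positions: by
   decreasing entry of the sequence, then decreasing color, then type. *)
Definition code (h m ty : nat) : nat := ((h * N + m) * 3 + ty)%N.
Definition label_level (B : nat) : nat := (B %/ 3 %/ N)%N.
Definition label_color (B : nat) : nat := ((B %/ 3) %% N)%N.

Lemma code_type h m ty : (ty < 3)%N -> (code h m ty %% 3)%N = ty.
Proof. by move=> ty3; rewrite /code modnMDl modn_small. Qed.

Lemma code_lev h m ty : (m < N)%N -> (ty < 3)%N ->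
  label_level (code h m ty) = h.
Proof.
by move=> mN ty3; rewrite /label_level /code divnMDl // (divn_small ty3) addn0
  divnMDl // divn_small // addn0.
Qed.

Lemma code_col h m ty : (m < N)%N -> (ty < 3)%N ->
  label_color (code h m ty) = m.
Proof.
by move=> mN ty3; rewrite /label_color /code divnMDl // (divn_small ty3) addn0
  modnMDl modn_small.
Qed.

Lemma codeK B : code (label_level B) (label_color B) (B %% 3) = B.
Proof. by rewrite /code /label_level /label_color -!divn_eq. Qed.

Lemma code_eq h m ty h' m' ty' : (m < N)%N -> (ty < 3)%N ->
  (m' < N)%N -> (ty' < 3)%N ->
  (code h m ty == code h' m' ty') = [&& h == h', m == m' & ty == ty'].
Proof.
move=> mN ty3 mN' ty3'; apply/eqP/and3P => [e|[/eqP-> /eqP-> /eqP->] //].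
split; apply/eqP.
- by rewrite -(code_lev h mN ty3) e code_lev.
- by rewrite -(code_col h mN ty3) e code_col.
- by rewrite -(code_type h m ty3) e code_type.
Qed.

Lemma code_ltn h m ty h' m' ty' : (m < N)%N -> (ty < 3)%N ->
  (m' < N)%N -> (ty' < 3)%N ->
  (code h m ty < code h' m' ty')%N =
  (h < h')%N || (h == h') && ((m < m')%N || (m == m') && (ty < ty')%N).
Proof.
move=> mN ty3 mN' ty3'; rewrite /code ltn_lex // ltn_lex //.
have -> : (h * N + m == h' * N + m')%N = (h == h') && (m == m').
  by have := @code_eq h m 0 h' m' 0 mN erefl mN' erefl;
     rewrite /code !addn0 eqn_pmul2r // eqxx andbT.
by case: ltngtP => //=; rewrite ?orbF.
Qed.

Definition nlabels : nat := (l.+1 * N * 3)%N.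

Lemma code_lt h m ty : (h <= l)%N -> (m < N)%N -> (ty < 3)%N ->
  (code h m ty < nlabels)%N.
Proof.
move=> hl mN ty3; have h1 : (h * N <= l * N)%N by rewrite leq_mul2r hl orbT.
by rewrite /code /nlabels mulSn; lia.
Qed.

Lemma label_level_lt (B : 'I_nlabels) : (label_level B < l.+1)%N.
Proof. by rewrite /label_level ltn_divLR // ltn_divLR //; apply: ltn_ord. Qed.

Lemma label_color_lt B : (label_color B < N)%N.
Proof. by rewrite ltn_mod. Qed.

Lemma cmp_type_lt a i : (cmp_type a i < 3)%N.
Proof. by rewrite /cmp_type; case: ifP => // _; case: ifP. Qed.

Let config := (colperm N n * n.-tuple 'I_l.+1)%type.
Implicit Types (x : config) (v : {ffun 'I_n -> 'I_nlabels}).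

Definition label x (i : 'I_n) : nat :=
  code (l - tnth x.2 i) (N.-1 - x.1.2 i) (cmp_type (x.1.1 i) i).

Lemma rev_color_lt (m : 'I_N) : (N.-1 - m < N)%N.
Proof. by apply: leq_ltn_trans (leq_subr _ _) _; rewrite prednK. Qed.

Lemma label_lt x i : (label x i < nlabels)%N.
Proof. by rewrite code_lt ?leq_subr ?rev_color_lt ?cmp_type_lt. Qed.

Definition to_word x : {ffun 'I_n -> 'I_nlabels} :=
  [ffun a => Ordinal (label_lt x (x.1.1^-1%g a))].

Lemma color_lt (B : nat) : (N.-1 - label_color B < N)%N.
Proof. by apply: leq_ltn_trans (leq_subr _ _) _; rewrite prednK. Qed.

Lemma entry_lt (B : nat) : (l - label_level B < l.+1)%N.
Proof. by rewrite ltnS leq_subr. Qed.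

(** The types recorded in [v] are ignored, so that this makes sense for every word; those of the
    resulting labels are recomputed from the permutation. *)
Definition of_word v : config :=
  ((std v, [ffun i => Ordinal (color_lt (v (std v i)))]),
   [tuple Ordinal (entry_lt (v (std v i))) | i < n]).

Definition label_mono x : bool :=
  [forall i : 'I_n, forall j : 'I_n, (i < j)%N ==>
     (label x i * n + x.1.1 i < label x j * n + x.1.1 j)%N].

Lemma of_wordK x : label_mono x -> of_word (to_word x) = x.
Proof.
move=> mx.
have stdE : std (to_word x) = x.1.1.
  apply: std_unique => i j ij; rewrite /word_key !ffunE /= !permK.
  by move/forallP/(_ i)/forallP/(_ j)/implyP: mx; apply.
case: x mx stdE => [[sg e] f] mx /= stdE.
rewrite /of_word stdE; congr (_, _, _).
  apply/ffunP => i; apply: val_inj; rewrite !ffunE /= permK code_col //=;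
    rewrite ?rev_color_lt ?cmp_type_lt //.
  by rewrite subKn // -ltnS prednK.
apply: eq_from_tnth => i; apply: val_inj; rewrite tnth_mktuple ffunE /= permK.
rewrite code_lev ?rev_color_lt ?cmp_type_lt // subKn //.
by rewrite -ltnS.
Qed.

Lemma label_of_word v i : label (of_word v) i =
  code (label_level (v (std v i))) (label_color (v (std v i)))
    (cmp_type (std v i) i).
Proof.
by rewrite /label /= tnth_mktuple ffunE /= !subKn // -ltnS ?prednK
  ?label_color_lt ?label_level_lt.
Qed.

(** Going to configurations and back replaces the recorded types with the actual ones: [v] is
    recovered if and only if they agree, and then the labels are monotone since [std v] sorts the
    keys. *)
Lemma good_wordE (s : seq nat) v :
  (forall B : 'I_nlabels, nth 0%N s B = (B %% 3)%N) ->
  label_mono (of_word v) && (to_word (of_word v) == v) = good_word s v.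
Proof.
move=> sE.
have wE a : to_word (of_word v) a =
    code (label_level (v a)) (label_color (v a)) (cmp_type a (word_pos v a))
    :> nat.
  rewrite ffunE /= label_of_word.
  by have -> : (std v)^-1%g a = word_pos v a;
    [rewrite -{1}[a](stdK v) permK | rewrite stdK].
apply/andP/forallP => [[_ /eqP vE] a|good].
  rewrite sE -{1}vE wE code_type ?cmp_type_lt //.
have type_pos i : cmp_type (std v i) i = (v (std v i) %% 3)%N.
  by have := good (std v i); rewrite sE word_posK => /eqP.
split; last first.
  apply/eqP/ffunP => a; apply: val_inj; rewrite /= wE -[a](stdK v) word_posK.
  by rewrite type_pos codeK.
apply/forallP => i; apply/forallP => j; apply/implyP => ij.
rewrite !label_of_word !type_pos !codeK /=.
by rewrite -!/(word_key v _) std_key_mono.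
Qed.

Definition in_DES_star (w : colperm N n) (i : nat) : bool :=
  [exists j : 'I_n, (nat_of_ord j == i) && (j \in DES_star w)].

Lemma in_DES_starE w (i : 'I_n) : in_DES_star w i = (i \in DES_star w).
Proof.
apply/existsP/idP => [[j /andP[/eqP/val_inj -> //]]|iD].
by exists i; rewrite eqxx.
Qed.

(** Both conditions are local: at consecutive positions, a decrease of the entry that is strict at
    descents is an increase of the key. The condition on the entries [l] comes from the first step,
    where 0 may belong to DES*. *)
Lemma desc_seq_label x :
  desc_seq (in_DES_star x.1) l (map val x.2) =
  label_mono x
  && [forall i, (tnth x.2 i == l :> nat) ==> (color x.1 i == 0%N)].
Proof.
case: x => [w f] /=; set fi := fun i => nat_of_ord (tnth f i).
have nthf (i : 'I_n) d : nth d (map val f) i = fi i.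
  by rewrite (nth_map (tnth f i)) ?size_tuple // -tnth_nth.
have DS (i j : 'I_n) : j.+1 = i ->
    in_DES_star w i = letter_lt (letter w i) (letter w j).
  move=> ji; rewrite in_DES_starE !inE -ji /= orbF.
  apply/existsP/idP => [[k /andP[]]|lt]; last by exists j; rewrite ji eqxx.
  by rewrite eqSS => /eqP/val_inj ->.
have D0 (i : 'I_n) : i = 0%N :> nat -> in_DES_star w i = (0 < color w i)%N.
  move=> i0; rewrite in_DES_starE !inE i0 /=.
  by rewrite (_ : [exists j, _] = false) //; apply/existsP => -[].
have fl i : (fi i <= l)%N by rewrite /fi -ltnS.
have colN i : (color w i <= N.-1)%N by rewrite /color -ltnS prednK.
have step (i j : 'I_n) : j.+1 = i ->
   (fi i + letter_lt (letter w i) (letter w j) <= fi j)%N =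
   (label (w, f) j * n + w.1 j < label (w, f) i * n + w.1 i)%N.
  move=> ji; rewrite ltn_lex // /label /= -!/(color w _) -!/(fi _).
  have ne : w.1 i != w.1 j :> nat.
    by apply/eqP => /val_inj/perm_inj ij; move: ji; rewrite ij; lia.
  (* If |pi| increases from one position to the next, |pi_i| - i increases weakly and so does the
     type: comparing types before values changes nothing. *)
  have cE : (cmp_type (w.1 j) j < cmp_type (w.1 i) i)%N
     || (cmp_type (w.1 j) j == cmp_type (w.1 i) i) && (w.1 j < w.1 i)%N
     = (w.1 j < w.1 i)%N.
    rewrite /cmp_type -ji; move: ne.
    by case: (ltngtP (w.1 j) j); case: (ltngtP (w.1 i) j.+1); lia.
  rewrite code_ltn ?cmp_type_lt ?ltnS ?rev_color_lt //.
  rewrite code_eq ?cmp_type_lt ?ltnS ?rev_color_lt //.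
  have := fl i; have := fl j; have := colN i; have := colN j; move: cE ne.
  rewrite /letter_lt /letter /=.
  move: (cmp_type _ _) (cmp_type _ _) (fi _) (fi _) (color _ _) (color _ _).
  lia.
apply/desc_seqP/andP => [H|[/forallP mx /forallP val0] i].
- have Hs (i j : 'I_n) : j.+1 = i ->
      (fi i + letter_lt (letter w i) (letter w j) <= fi j)%N.
    move=> ji; have := H i; rewrite size_map size_tuple nthf (DS i j ji).
    by rewrite -{2}ji /= nthf; apply.
  split; apply/forallP => i.
    apply/forallP => j; apply/implyP.
    apply: (@ltn_mono_succ _ (fun i => label (w, f) i * n + w.1 i)%N).
    move=> {}i {}j ij.
    by rewrite -step // Hs.
  (* The entries equal to [l] form an initial segment without descents, along which the color cannot
     rise above that of the first letter, which is 0. *)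
  case: i => i iN; elim: i iN => [|i IH] iN; apply/implyP => /eqP fil.
    have := H 0%N; rewrite size_map size_tuple (nthf (Ordinal iN)).
    by rewrite (D0 (Ordinal iN)) //= => /(_ iN); rewrite /fi fil; lia.
  have iN' := ltnW iN; have := Hs (Ordinal iN) (Ordinal iN') erefl.
  have := IH iN'; have := fl (Ordinal iN'); rewrite /fi fil /letter_lt /=.
  by case: eqP; lia.
- rewrite size_map size_tuple => iN; rewrite (nthf (Ordinal iN)).
  case: i iN => [|i] iN /=.
    rewrite (D0 (Ordinal iN)) //; have := val0 (Ordinal iN).
    by have := fl (Ordinal iN); rewrite /fi; case: eqP; lia.
  rewrite (DS (Ordinal iN) (Ordinal (ltnW iN))) //.
  rewrite (nthf (Ordinal (ltnW iN))) step //.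
  by have /forallP/(_ (Ordinal iN))/implyP := mx (Ordinal (ltnW iN)); apply.
Qed.

End Labels.


(** * Generating functions of colored permutations *)

Section Weights.
Variables (R : comUnitRingType) (t q : R) (r s : nat -> R).

(** Letters of nonzero color are smaller than all those of color 0, so [t] only occurs in color
    0. *)
Definition type_weight (m ty : nat) : R :=
  if m == 0%N then (if ty == 0%N then 1 else if ty == 1%N then r 0 else t)
  else s m * (if ty == 1%N then r m else 1).

Lemma prod_card_set (I : finType) (P : pred I) (a : R) :
  a ^+ #|[set i | P i]| = \prod_i (if P i then a else 1).
Proof.
by rewrite -big_mkcond -prodr_const; apply: eq_bigl => i; rewrite inE.
Qed.

Lemma stat_weight N n (w : colperm N n) : (0 < N)%N ->
  t ^+ exc w * (\prod_(0 <= k < N) r k ^+ fix_ k w)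
    * (\prod_(1 <= m < N) s m ^+ col_ m w)
  = \prod_(i < n) type_weight (w.2 i) (cmp_type (w.1 i) i).
Proof.
move=> N0; rewrite /exc /fix_ /col_ prod_card_set.
rewrite (eq_bigr (fun k => \prod_(i < n)
    (if letter w i == (nat_of_ord i, k) then r k else 1)))
    => [|k _]; last first.
  by rewrite prod_card_set.
rewrite [X in _ * X](eq_bigr (fun m => \prod_(i < n)
    (if color w i == m then s m else 1))) => [|k _]; last first.
  by rewrite prod_card_set.
rewrite exchange_big [X in _ * X]exchange_big -!big_split /=.
apply: eq_bigr => i _; rewrite /letter_lt /letter /color /=.
have prodN (F : nat -> R) a k : (a <= k < N)%N ->
    \prod_(a <= j < N) (if k == j then F j else 1) = F k.
  move=> kN; rewrite -big_mkcond (eq_bigl (fun j => j == k)) => [|j].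
    by rewrite big_nat1_eq kN.
  by rewrite eq_sym.
have iN := ltn_ord (w.2 i); rewrite /type_weight /cmp_type.
have -> : \prod_(0 <= k < N) (if (nat_of_ord (w.1 i), nat_of_ord (w.2 i))
      == (nat_of_ord i, k) then r k else 1)
    = if w.1 i == i then r (w.2 i) else 1.
  case: eqP => [->|ne].
    rewrite -(prodN r 0%N (w.2 i)) //; apply: eq_bigr => k _.
    by rewrite xpair_eqE eqxx.
  by rewrite big1 // => k _; rewrite xpair_eqE (introF eqP) // => /val_inj.
have -> : \prod_(1 <= m < N) (if nat_of_ord (w.2 i) == m then s m else 1)
    = if nat_of_ord (w.2 i) == 0%N then 1 else s (w.2 i).
  case: eqP => [->|ne]; last by rewrite prodN //; lia.
  by rewrite big_nat big1 // => m; case: m.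
rewrite -val_eqE /=.
case: (nat_of_ord (w.2 i)) => [|m] /=.
  by case: ltngtP; rewrite ?mulr1 ?mul1r.
by rewrite mul1r mulrC; case: ltngtP.
Qed.

Variables (N l : nat).

(* If the first entries equal l, then 0 is not in DES*: the first letter, hence
   all those of the entries l, have color 0.  Other labels get weight 0. *)
Definition letter_weight (B : nat) : R :=
  let f := (l - label_level N B)%N in
  let m := (N.-1 - label_color N B)%N in
  if (f == l) && (m != 0%N) then 0 else q ^+ f * type_weight m (B %% 3).

Definition letters : seq (nat * R) :=
  [seq (B %% 3, letter_weight B)%N | B <- iota 0 (nlabels N l)].

Lemma colperm_sum n : (0 < N)%N ->
  \sum_(w : colperm N n)
    \sum_(f : n.-tuple 'I_l.+1 | desc_seq (in_DES_star w) l (map val f))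
     t ^+ exc w * (\prod_(0 <= k < N) r k ^+ fix_ k w)
       * (\prod_(1 <= m < N) s m ^+ col_ m w) * q ^+ sumn (map val f)
  = fps_coef (phi letters) n.
Proof.
move=> N0; have szl : size letters = nlabels N l by rewrite size_map size_iota.
have nthl (B : 'I_(nlabels N l)) : nth 0%N (types letters) B = (B %% 3)%N.
  by rewrite /types -map_comp (nth_map 0%N) ?size_iota // nth_iota.
rewrite -(good_word_sum n szl); last first.
  by apply/allP => B /mapP[y /mapP[B' _ ->] ->]; rewrite ltn_mod.
rewrite pair_big_dep /=.
pose wt (x : colperm N n * n.-tuple 'I_l.+1) :=
  \prod_i letter_weight (label x i).
transitivity (\sum_(x : colperm N n * n.-tuple 'I_l.+1 | label_mono x) wt x).
  rewrite [RHS]big_mkcond [LHS]big_mkcond; apply: eq_bigr => x _.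
  rewrite desc_seq_label //; case: (label_mono x) => //=.
  have wtE i : letter_weight (label x i) =
      if (tnth x.2 i == l :> nat) && (x.1.2 i != 0%N :> nat) then 0
      else q ^+ tnth x.2 i * type_weight (x.1.2 i) (cmp_type (x.1.1 i) i).
    rewrite /letter_weight /label code_lev ?code_col ?code_type ?rev_color_lt
      ?cmp_type_lt // !subKn //; first by rewrite -ltnS prednK.
    by rewrite -ltnS.
  case: ifP => [/forallP H|/negbT]; last first.
    rewrite negb_forall => /existsP[i]; rewrite negb_imply => /andP[il ic].
    by rewrite /wt (bigD1 i) //= wtE il ic mul0r.
  rewrite stat_weight // /wt (eq_bigr _ (fun i _ => wtE i)).
  have -> : q ^+ sumn (map val x.2) = \prod_(i < n) q ^+ tnth x.2 i.
    by rewrite -expr_sum sumnE big_map big_tuple.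
  rewrite -big_split; apply: eq_bigr => i _ /=; rewrite mulrC.
  case: ifP => // /andP[il ic].
  by have := H i; rewrite il /= /color (negbTE ic).
(* Configurations with monotone labels correspond to good words. *)
rewrite (reindex_onto (@of_word N l n N0) (@to_word N l n N0)) /=; last first.
  exact: of_wordK.
apply: eq_big => [v|v /andP[_ /eqP vE]]; first exact: good_wordE.
rewrite /wt.
rewrite [RHS](reindex_inj (@perm_inj _ (std v))) /=; apply: eq_bigr => i _.
rewrite -map_comp (nth_map 0%N) ?size_iota // nth_iota // add0n /=.
by have /= := congr1 (fun u : {ffun _ -> 'I__} => nat_of_ord (u (std v i))) vE;
  rewrite ffunE /= permK => ->.
Qed.

End Weights.


(** * Closed form of the series of the alphabet of labels *)

Lemma map_iota_mul (T : Type) (F : nat -> T) a b o :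
  [seq F B | B <- iota (o * b) (a * b)] =
  flatten [seq [seq F (i * b + j)%N | j <- iota 0 b] | i <- iota o a].
Proof.
elim: a o => //= a IH o; rewrite mulSn iotaD map_cat -IH mulSn addnC.
congr (_ ++ _); rewrite -{1}[(o * b)%N]addn0 iotaDl -map_comp.
by apply: eq_map.
Qed.

Section Evaluation.
Variable R : comUnitRingType.
Implicit Types s : seq (nat * R).

Definition wstep (y : nat * R) (W : fps R) : fps R :=
  if y.1 == 0%N then (1 - fpsC y.2 * fpsX) * W
  else if y.1 == 1%N then W
  else (W - fpsC y.2 * fpsX) / (1 - fpsC y.2 * fpsX).

Lemma wserE s : wser s = foldr wstep 1 s.
Proof. by elim: s => [|[ty w] s IH] //=; rewrite IH. Qed.

Definition type_prod (ty : nat) s : fps R :=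
  \prod_(y <- s | y.1 == ty) (1 - fpsC y.2 * fpsX).

(** The product of [phi] and [wser] is unchanged by letters of type 2, divided by 1 - w z for type 1
    and multiplied by it for type 0. *)
Lemma phi_prod s : phi s * (type_prod 1 s * wser s) = type_prod 0 s.
Proof.
rewrite /type_prod; elim: s => [|[ty w] s IH]; first by rewrite !big_nil !mulr1.
have U := fps_unit_1subX (fpsC w); have UW := wser_unit ((ty, w) :: s).
rewrite !big_cons /=; move: UW => /=; case: ty => [|[|ty]] /= UW.
- by rewrite -IH; ring.
- rewrite -IH -[RHS]mul1r -[X in _ = X * _](mulVr U); ring.
- rewrite -IH -[RHS]mul1r -[X in _ = X * _](mulVr UW); ring.
Qed.

End Evaluation.

Arguments wstep {R}.

Section Letters.
Variables (R : comUnitRingType) (t q : R) (r s : nat -> R) (N l : nat).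
Hypothesis N_gt0 : (0 < N)%N.

Let wt := letter_weight t q r s N l.

Definition letter3 (h m : nat) : seq (nat * R) :=
  [seq (ty, wt (code N h m ty)) | ty <- iota 0 3].

Lemma lettersE : letters t q r s N l =
  flatten [seq flatten [seq letter3 h m | m <- iota 0 N] | h <- iota 0 l.+1].
Proof.
have e : iota 0 (nlabels N l) = iota (0 * (N * 3)) (l.+1 * (N * 3)).
  by rewrite /nlabels -mulnA.
rewrite /letters e map_iota_mul; congr flatten; apply: eq_map => h.
have -> : iota 0 (N * 3) = iota (0 * 3) (N * 3) by [].
rewrite (map_iota_mul (fun j => (_, _))).
congr flatten; apply: eq_map => m; apply/eq_in_map => ty.
rewrite mem_iota => ty3.
have -> : (h * (N * 3) + (m * 3 + ty) = code N h m ty)%N.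
  by rewrite /code mulnDl mulnA addnA.
by rewrite code_type.
Qed.

Let x f : fps R := fpsC (q ^+ f) * fpsX.

Lemma letter_weightE h m ty : (h <= l)%N -> (m < N)%N -> (ty < 3)%N ->
  wt (code N h (N.-1 - m) ty) =
  if (h == 0%N) && (m != 0%N) then 0 else q ^+ (l - h) * type_weight t r s m ty.
Proof.
move=> hl mN ty3; rewrite /wt /letter_weight.
have mN' := rev_color_lt N_gt0 (Ordinal mN).
rewrite code_lev ?code_col ?code_type //.
rewrite subKn; last by rewrite -ltnS prednK.
by rewrite (_ : (l - h == l)%N = (h == 0%N)) //; lia.
Qed.

Lemma wstep3_0 h W : (h <= l)%N ->
  foldr wstep W (letter3 h (N.-1 - 0)) =
  (1 - x (l - h)) * ((W - fpsC t * x (l - h)) / (1 - fpsC t * x (l - h))).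
Proof.
move=> hl; rewrite /letter3 /wstep [map _ _]/= [foldr _ _ _]/=.
rewrite !letter_weightE // andbF /type_weight /= mulr1.
by rewrite /x mulrA -rmorphM /= [t * _]mulrC.
Qed.

(** In a nonzero color, types 0 and 2 have the same weight: their factors 1 - w z cancel and a
    translation remains. *)
Lemma wstep3 h m W : (h <= l)%N -> (0 < m < N)%N ->
  foldr wstep W (letter3 h (N.-1 - m)) =
  if h == 0%N then W else W - fpsC (s m) * x (l - h).
Proof.
move=> hl /andP[m0 mN]; rewrite /letter3 /wstep /= !letter_weightE //.
rewrite /type_weight (_ : (m == 0%N) = false) /= ?mulr1 ?andbT; last by lia.
case: eqP => _; first by rewrite rmorph0 mul0r !subr0 invr1 mulr1 mul1r.
have -> : fpsC (s m) * x (l - h) = fpsC (q ^+ (l - h) * s m) * fpsX.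
  by rewrite /x mulrA -rmorphM /= [s m * _]mulrC.
by rewrite mulrC divrK // fps_unit_1subX.
Qed.

(** [foldr] starts from the last labels, those of color 0; the other colors then act by
    translations, which add up. *)
Lemma wblock h W : (h <= l)%N ->
  foldr wstep W (flatten [seq letter3 h m | m <- iota 0 N]) =
  (1 - x (l - h)) * ((W - fpsC t * x (l - h)) / (1 - fpsC t * x (l - h)))
  - (if h == 0%N then 0 else fpsC (\sum_(1 <= m < N) s m) * x (l - h)).
Proof.
move=> hl; suff H j : (j <= N.-1)%N ->
    foldr wstep W (flatten [seq letter3 h m | m <- iota (N.-1 - j) j.+1]) =
    (1 - x (l - h)) * ((W - fpsC t * x (l - h)) / (1 - fpsC t * x (l - h)))
    - (if h == 0%N then 0 else fpsC (\sum_(1 <= m < j.+1) s m) * x (l - h)).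
  by have := H N.-1 (leqnn _); rewrite subnn prednK.
elim: j => [_|j IH jN].
  have -> : flatten [seq letter3 h m | m <- iota (N.-1 - 0) 1]
      = letter3 h (N.-1 - 0) by exact: cats0.
  by rewrite wstep3_0 // big_geq // rmorph0 mul0r if_same subr0.
have -> : flatten [seq letter3 h m | m <- iota (N.-1 - j.+1) j.+2]
    = letter3 h (N.-1 - j.+1)
      ++ flatten [seq letter3 h m | m <- iota (N.-1 - j) j.+1].
  by have -> : (N.-1 - j = (N.-1 - j.+1).+1)%N by lia.
rewrite foldr_cat IH ?(ltnW jN) // wstep3 //; last by lia.
case: eqP => // _; rewrite [in RHS]big_nat_recr //= [in RHS]rmorphD mulrDl /=.
ring.
Qed.

(* wser of the labels whose entry is smaller than j, when j <= l. *)
Fixpoint vser (j : nat) : fps R :=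
  if j is i.+1 then
    (1 - x i) * ((vser i - fpsC t * x i) / (1 - fpsC t * x i))
    - fpsC (\sum_(1 <= m < N) s m) * x i
  else 1.

Lemma wser_letters : wser (letters t q r s N l) =
  (1 - x l) * ((vser l - fpsC t * x l) / (1 - fpsC t * x l)).
Proof.
rewrite wserE lettersE.
suff H j : (j <= l)%N -> foldr wstep 1 (flatten
    [seq flatten [seq letter3 h m | m <- iota 0 N] | h <- iota (l.+1 - j) j])
    = vser j.
  have -> : iota 0 l.+1 = 0%N :: iota (l.+1 - l) l by rewrite subSnn.
  by rewrite /= foldr_cat H // wblock // subn0 subr0.
elim: j => [//|j IH] jl.
have -> : iota (l.+1 - j.+1) j.+1 = (l - j)%N :: iota (l.+1 - j) j.
  by rewrite subSS subSn // ltnW.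
rewrite /= foldr_cat IH ?(ltnW jl) // wblock ?leq_subr // subKn ?(ltnW jl) //.
by rewrite (_ : (l - j == 0)%N = false) //; lia.
Qed.

Lemma type_prod_letters ty : type_prod ty (letters t q r s N l) =
  \prod_(h <- iota 0 l.+1) \prod_(m <- iota 0 N)
     \prod_(y <- letter3 h m | y.1 == ty) (1 - fpsC y.2 * fpsX).
Proof.
rewrite /type_prod lettersE big_flatten big_map; apply: eq_bigr => h _.
by rewrite big_flatten big_map.
Qed.

Let Q : fps R := fpsC q.
Let T : fps R := fpsC t.
Let Z : fps R := fpsX.

(** Color 0 occurs with the entries 0, ..., l. The other colors have weight 0 at the entry [l],
    which leaves [l] factors. *)
Lemma type_prod_lettersE ty : (ty < 2)%N ->
  type_prod ty (letters t q r s N l) =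
  qpoch (fpsC (type_weight t r s 0 ty) * Z) Q l.+1 *
  \prod_(1 <= m < N) qpoch (fpsC (type_weight t r s m ty) * Z) Q l.
Proof.
move=> ty2; have ty3 : (ty < 3)%N by lia.
have factorE m f : 1 - fpsC (q ^+ f * type_weight t r s m ty) * Z =
    1 - fpsC (type_weight t r s m ty) * Z * Q ^+ f.
  by rewrite rmorphM rmorphXn /= [_ * fpsC _]mulrC mulrAC.
have inner h m : (h <= l)%N -> (m < N)%N ->
    \prod_(y <- letter3 h (N.-1 - m) | y.1 == ty) (1 - fpsC y.2 * fpsX) =
    if (h == 0%N) && (m != 0%N) then 1
    else 1 - fpsC (type_weight t r s m ty) * Z * Q ^+ (l - h).
  move=> hl mN; transitivity (1 - fpsC (wt (code N h (N.-1 - m) ty)) * fpsX).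
    rewrite /letter3 /= !big_cons big_nil /=.
    by case: ty ty2 {ty3 factorE} => [|[|//]] _ /=; rewrite mulr1.
  rewrite letter_weightE //; case: ifP => _; last exact: factorE.
  by rewrite rmorph0 mul0r subr0.
have middle h : (h <= l)%N -> \prod_(m <- iota 0 N)
    \prod_(y <- letter3 h m | y.1 == ty) (1 - fpsC y.2 * fpsX) =
    (1 - fpsC (type_weight t r s 0 ty) * Z * Q ^+ (l - h)) *
    (if h == 0%N then 1 else \prod_(1 <= m < N)
       (1 - fpsC (type_weight t r s m ty) * Z * Q ^+ (l - h))).
  move=> hl.
  have -> : iota 0 N = index_iota 0 N by rewrite /index_iota subn0.
  rewrite big_nat_rev (eq_big_nat _ _ (F2 := fun m =>
      if (h == 0%N) && (m != 0%N) then 1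
      else 1 - fpsC (type_weight t r s m ty) * Z * Q ^+ (l - h))).
    rewrite big_ltn // andbF; congr (_ * _); case: eqP => _.
      by rewrite big_nat big1 // => -[].
    by apply: eq_big_nat => m _.
  move=> m /andP[_ mN]; rewrite -inner // add0n.
  by have -> : (N - m.+1 = N.-1 - m)%N by lia.
have -> : type_prod ty (letters t q r s N l) =
    \prod_(f < l.+1) (1 - fpsC (type_weight t r s 0 ty) * Z * Q ^+ f) *
    \prod_(f < l.+1) (if f == l :> nat then 1 else \prod_(1 <= m < N)
       (1 - fpsC (type_weight t r s m ty) * Z * Q ^+ f)).
  rewrite type_prod_letters -[iota 0 l.+1]/(index_iota 0 l.+1) big_nat_rev.
  rewrite -big_split big_mkord; apply: eq_bigr => f _ /=.
  have fl : (f <= l)%N by rewrite -ltnS.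
  rewrite add0n subSS middle ?leq_subr // subKn //.
  by have -> : (l - f == 0)%N = (f == l :> nat) by lia.
rewrite [X in _ * X]big_ord_recr /= eqxx mulr1; congr (_ * _).
rewrite exchange_big; apply: eq_bigr => f _ /=.
by rewrite ltn_eqF.
Qed.

(** The solution of the affine recursion defining [vser], with denominators cleared. It is stated
    for [vser j - T * x j], the numerator in the next step of the recursion. *)
Lemma vserE j :
  (1 - T * Q) * qpoch (T * Q * Z) Q j * (vser j - T * x j) =
  (1 - T * x j) * ((1 + \sum_(1 <= m < N) fpsC (s m)) * qpoch Z Q j
    - (T * Q + \sum_(1 <= m < N) fpsC (s m)) * qpoch (T * Q * Z) Q j).
Proof.
have xE i : x i = Z * Q ^+ i by rewrite /x rmorphXn mulrC.
elim: j => [|j IH].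
  by rewrite /qpoch !big_ord0 /= xE expr0; ring.
have U : 1 - T * x j \is a GRing.unit.
  by rewrite /x mulrA -rmorphM fps_unit_1subX.
set sg := \sum_(1 <= m < N) fpsC (s m) in IH *.
have sgE : fpsC (\sum_(1 <= m < N) s m) = sg by rewrite rmorph_sum.
rewrite /= sgE -/T /qpoch !big_ord_recr /= -!/(qpoch _ _ _).
have xS : x j.+1 = Q * x j by rewrite !xE exprS; ring.
have -> : T * Q * Z * Q ^+ j = T * Q * x j by rewrite xE; ring.
rewrite -xE xS; set W := (_ - _) / _ in IH *.
(* Cancelling 1 - t x_j gives the closed form of the fraction W that enters [vser j.+1]. *)
have {}IH : (1 - T * Q) * qpoch (T * Q * Z) Q j * W =
    (1 + sg) * qpoch Z Q j - (T * Q + sg) * qpoch (T * Q * Z) Q j.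
  apply: (mulrI U); rewrite -IH /W mulrCA; congr (_ * _).
  by rewrite mulrC divrK.
transitivity ((1 - T * Q * x j) * ((1 - x j)
    * ((1 - T * Q) * qpoch (T * Q * Z) Q j * W)
    - (1 - T * Q) * qpoch (T * Q * Z) Q j * (sg + T * Q) * x j)).
  by rewrite /qpoch; ring.
by rewrite IH /qpoch; ring.
Qed.

Lemma qpoch_coef0 (c : fps R) k :
  fps_coef (qpoch (c * Z) Q k) 0 = 1.
Proof.
elim: k => [|k IH]; first by rewrite /qpoch big_ord0 fps_coef1.
rewrite /qpoch big_ord_recr /= -/(qpoch _ _ _) fps_coefM0 IH mul1r.
by rewrite fps_coefD fps_coefN fps_coef1 mulrAC [_ * Z]mulrC fps_coefXM subr0.
Qed.

Let num : fps R := (1 - T * Q) * qpoch Z Q l * qpoch (T * Q * Z) Q l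
  * \prod_(1 <= m < N) qpoch (fpsC (s m) * Z) Q l.
Let bracket : fps R :=
  (1 + \sum_(1 <= m < N) fpsC (s m)) * qpoch Z Q l
  - (T * Q + \sum_(1 <= m < N) fpsC (s m)) * qpoch (T * Q * Z) Q l.
Let den : fps R := \prod_(1 <= m < N) qpoch (fpsC (r m) * fpsC (s m) * Z) Q l
  * qpoch (fpsC (r 0%N) * Z) Q l.+1 * bracket.

Hypothesis tq_unit : 1 - t * q \is a GRing.unit.

(** The constant coefficient of [den] is (1 + sum s_m) - (tq + sum s_m) = 1 - tq, the q-Pochhammer
    symbols having constant coefficient 1. *)
Lemma den_unit : den \is a GRing.unit.
Proof.
have qU c k : qpoch (c * Z) Q k \is a @GRing.unit (fps R).
  exact/fps_unit1/qpoch_coef0.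
rewrite /den !unitrM qU andbT; apply/andP; split.
  by rewrite big_seq; apply: rpred_prod => m _; apply: qU.
rewrite fps_unitE /bracket fps_coefD fps_coefN !fps_coefM0 qpoch_coef0.
rewrite -[Z]mul1r qpoch_coef0 !mulr1.
rewrite !fps_coefD fps_coef1 fps_coefM0 /= opprD addrACA subrr addr0.
exact: tq_unit.
Qed.

Lemma phi_letters : phi (letters t q r s N l) = num / den.
Proof.
apply: (canRL (mulrK den_unit)).
have := phi_prod (letters t q r s N l).
rewrite !type_prod_lettersE // wser_letters.
have -> : \prod_(1 <= m < N) qpoch (fpsC (type_weight t r s m 0) * Z) Q l
    = \prod_(1 <= m < N) qpoch (fpsC (s m) * Z) Q l.
  by apply: eq_big_nat => -[|m] // _; rewrite /type_weight /= mulr1.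
have -> : \prod_(1 <= m < N) qpoch (fpsC (type_weight t r s m 1) * Z) Q l
    = \prod_(1 <= m < N) qpoch (fpsC (r m) * fpsC (s m) * Z) Q l.
  apply: eq_big_nat => -[|m] // _.
  by rewrite /type_weight /= rmorphM /= [fpsC (s _) * _]mulrC.
rewrite /type_weight /= rmorph1 mul1r -/T.
have xE : x l = Z * Q ^+ l by rewrite /x rmorphXn mulrC.
have U1 : 1 - x l \is a GRing.unit by rewrite /x fps_unit_1subX.
have U2 : 1 - T * x l \is a GRing.unit.
  by rewrite /x mulrA -rmorphM fps_unit_1subX.
have V := vserE l; rewrite -/bracket in V.
set P := \prod_(1 <= m < N) qpoch (fpsC (s m) * _) _ _.
rewrite /num /den -/P.
set F := \prod_(1 <= m < N) _; set G := qpoch (_ * _) _ l.+1.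
have -> : qpoch Z Q l.+1 = qpoch Z Q l * (1 - x l).
  by rewrite /qpoch big_ord_recr xE.
set W := (_ - _) / _ => E.
have VW : (1 - T * Q) * qpoch (T * Q * Z) Q l * W = bracket.
  apply: (mulrI U2); rewrite -V /W mulrCA; congr (_ * _).
  by rewrite mulrC divrK.
(* The factor 1 - x_l occurs both in [wser] of the letters and as the last factor of (z;q)_{l+1}: it
   cancels. *)
rewrite -VW; apply: (mulrI U1).
transitivity ((1 - T * Q) * qpoch (T * Q * Z) Q l
  * (phi (letters t q r s N l) * (G * F * ((1 - x l) * W)))); first by ring.
by rewrite E; ring.
Qed.

End Letters.


(** * Coefficients of both sides in z and p *)

Lemma fpsC_qpoch (R : comUnitRingType) (a q : R) n :
  qpoch (fpsC a) (fpsC q) n = fpsC (qpoch a q n).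
Proof.
rewrite /qpoch rmorph_prod; apply: eq_bigr => i _ /=.
by rewrite rmorphB rmorph1 rmorphM rmorphXn.
Qed.

(** Each element i of DES* contributes p q^i; the possible element 0 contributes only p, so the
    exponent of q is [maj]. *)
Lemma desc_fps_maj (R : comUnitRingType) (q : R) N n (w : colperm N n) :
  desc_fps q n (in_DES_star w) =
  fpsC q ^+ maj w * fpsX ^+ des_star w / qpoch fpsX (fpsC q) n.+1.
Proof.
rewrite /desc_fps; congr (_ / _).
rewrite (eq_bigr (fun i : 'I_n => (if i \in DES_star w then fpsX else 1)
    * (if i \in DES w then fpsC q ^+ i else 1))) => [|i _]; last first.
  rewrite in_DES_starE exprMn; congr (_ * _); first by case: (i \in _).
  rewrite [i \in DES_star w]inE; case: (i \in DES w); first by rewrite expr1.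
  rewrite inE; case: eqP => [->|_] /=; last by rewrite expr0.
  by rewrite expr0 expr1n.
rewrite big_split /= -!big_mkcond prodr_const mulrC /maj; congr (_ * _).
by rewrite expr_sum.
Qed.

Section Coefficients.
Variables (R : comUnitRingType) (N : nat) (t q : R) (r s : nat -> R).
Hypothesis N_gt0 : (0 < N)%N.

Let stat n (w : colperm N n) : R := t ^+ exc w
  * (\prod_(0 <= k < N) r k ^+ fix_ k w) * (\prod_(1 <= m < N) s m ^+ col_ m w).

Lemma fps2_coef_desc n (w : colperm N n) i j :
  fps2_coef (fps2z R ^+ n * fps2C (stat w)
             * desc_fps (fpsC q) n (in_DES_star w)) i j =
  if i == n then \sum_(f : n.-tuple 'I_j.+1 |
      desc_seq (in_DES_star w) j (map val f)) stat w * q ^+ sumn (map val f)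
  else 0.
Proof.
rewrite /fps2_coef /fps2z /fps2C -rmorphXn -rmorphM /= fps_coefCM.
rewrite (desc_fps_coef _ _ _ (ltnSn j)).
under [X in _ * X]eq_bigr do rewrite -rmorphXn.
rewrite -rmorph_sum /= -mulrA -rmorphM /= fps_coefXnM.
have [->|ne] := eqVneq i n; first by rewrite leqnn subnn mulr_sumr.
case: ifP => // ni; rewrite /fps_coef /= subn_eq0.
by rewrite leq_eqVlt (negbTE ne) ltnNge ni.
Qed.

Lemma stat_termE n (w : colperm N n) :
  fps2z R ^+ n / qpoch (fps2p R) (fps2C q) n.+1 * fps2C t ^+ exc w
    * (\prod_(0 <= k < N) fps2C (r k) ^+ fix_ k w)
    * (\prod_(1 <= m < N) fps2C (s m) ^+ col_ m w)
    * fps2C q ^+ maj w * fps2p R ^+ des_star w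
  = fps2z R ^+ n * fps2C (stat w) * desc_fps (fpsC q) n (in_DES_star w).
Proof.
have -> : fps2C (stat w) = fps2C t ^+ exc w
    * (\prod_(0 <= k < N) fps2C (r k) ^+ fix_ k w)
    * (\prod_(1 <= m < N) fps2C (s m) ^+ col_ m w).
  rewrite /fps2C /stat !rmorphM !rmorphXn !rmorph_prod /=.
  by do 2?congr (_ * _); apply: eq_bigr => k _; rewrite !rmorphXn.
rewrite desc_fps_maj -/(fps2C q) -/(fps2p R); ring.
Qed.

Lemma fps2_coef_sum (I : Type) (a : seq I) (P : pred I)
    (F : I -> fps (fps R)) i j :
  fps2_coef (\sum_(k <- a | P k) F k) i j
  = \sum_(k <- a | P k) fps2_coef (F k) i j.
Proof. by rewrite /fps2_coef !fps_coef_sum. Qed.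

Lemma colperm_term_coef n i j :
  fps2_coef (\sum_(w : colperm N n)
    fps2z R ^+ n / qpoch (fps2p R) (fps2C q) n.+1 * fps2C t ^+ exc w
      * (\prod_(0 <= k < N) fps2C (r k) ^+ fix_ k w)
      * (\prod_(1 <= m < N) fps2C (s m) ^+ col_ m w)
      * fps2C q ^+ maj w * fps2p R ^+ des_star w) i j
  = if i == n then fps_coef (phi (letters t q r s N j)) n else 0.
Proof.
rewrite fps2_coef_sum.
under eq_bigr do rewrite stat_termE fps2_coef_desc.
by case: eqP => _; [apply: colperm_sum | rewrite big1].
Qed.

Hypothesis tq_unit : 1 - t * q \is a GRing.unit.

Lemma level_termE l :
  (fps2p R ^+ l * (1 - fps2C t * fps2C q) * qpoch (fps2z R) (fps2C q) l
     * qpoch (fps2C t * fps2C q * fps2z R) (fps2C q) l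
     * (\prod_(1 <= m < N) qpoch (fps2C (s m) * fps2z R) (fps2C q) l))
  / ((\prod_(1 <= m < N)
        qpoch (fps2C (r m) * fps2C (s m) * fps2z R) (fps2C q) l)
     * qpoch (fps2C (r 0%N) * fps2z R) (fps2C q) l.+1
     * ((1 + \sum_(1 <= m < N) fps2C (s m)) * qpoch (fps2z R) (fps2C q) l
        - (fps2C t * fps2C q + \sum_(1 <= m < N) fps2C (s m))
          * qpoch (fps2C t * fps2C q * fps2z R) (fps2C q) l))
  = fps2p R ^+ l * fpsC (phi (letters t q r s N l)).
Proof.
rewrite phi_letters // rmorphM /= rmorphV ?den_unit //=.
rewrite /fps2C /fps2z.
have E1 : \prod_(1 <= m < N)
      qpoch (fpsC (fpsC (s m)) * fpsC fpsX) (fpsC (fpsC q)) l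
    = fpsC (\prod_(1 <= m < N) qpoch (fpsC (s m) * fpsX) (fpsC q) l).
  by rewrite rmorph_prod; apply: eq_bigr => m _; rewrite -rmorphM fpsC_qpoch.
have E2 : \prod_(1 <= m < N) qpoch
      (fpsC (fpsC (r m)) * fpsC (fpsC (s m)) * fpsC fpsX) (fpsC (fpsC q)) l
    = fpsC (\prod_(1 <= m < N)
        qpoch (fpsC (r m) * fpsC (s m) * fpsX) (fpsC q) l).
  by rewrite rmorph_prod; apply: eq_bigr => m _; rewrite -!rmorphM fpsC_qpoch.
rewrite [X in _ * X / _ = _]E1 [X in _ / (X * _ * _) = _]E2.
rewrite -!(rmorphM (@fpsC _)).
rewrite !fpsC_qpoch.
rewrite -!(rmorph_sum (@fpsC _)).
set P1 := \prod_(1 <= m < N) _; set P2 := \prod_(1 <= m < N) _.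
set A := qpoch _ _ _; set B := qpoch _ _ _; set C := qpoch _ _ _.
by rewrite !(rmorphM, rmorphB, rmorphD, rmorph1) /= !mulrA.
Qed.

End Coefficients.

Theorem theorem1p5 (N : nat) (R : comUnitRingType) (t0 q0 : R)
    (r0 s0 : nat -> R) :
  (0 < N)%N ->
  1 - t0 * q0 \is a GRing.unit ->
  let z := fps2z R in
  let p := fps2p R in
  let t := fps2C t0 in
  let q := fps2C q0 in
  let r := fun k : nat => fps2C (r0 k) in
  let s := fun m : nat => fps2C (s0 m) in
  exists S : fps (fps R),
    fps2_has_sum
      (fun n : nat => \sum_(w : colperm N n)
         z ^+ n / qpoch p q n.+1
         * t ^+ exc w
         * (\prod_(0 <= k < N) r k ^+ fix_ k w)
         * (\prod_(1 <= m < N) s m ^+ col_ m w)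
         * q ^+ maj w
         * p ^+ des_star w) S
    /\
    fps2_has_sum
      (fun l : nat =>
         (p ^+ l * (1 - t * q) * qpoch z q l * qpoch (t * q * z) q l
            * (\prod_(1 <= m < N) qpoch (s m * z) q l))
         / ((\prod_(1 <= m < N) qpoch (r m * s m * z) q l)
            * qpoch (r 0%N * z) q l.+1
            * ((1 + \sum_(1 <= m < N) s m) * qpoch z q l
               - (t * q + \sum_(1 <= m < N) s m) * qpoch (t * q * z) q l))) S.
Proof.
move=> N0 tq z p t q r s.
(* The coefficient of p^l in the common sum is the series in z of the good words on the labels for
   [l]. *)
exists (Fps (fun l => phi (letters t0 q0 r0 s0 N l))); split=> i j.
(* The n-th term is z^n times a series in p: only n = i contributes. *)
- exists i.+1 => m im; rewrite fps2_coef_sum (bigD1 (Ordinal im)) //=.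
  rewrite colperm_term_coef // eqxx big1 ?addr0 // => n ne.
  rewrite colperm_term_coef // eq_sym -[i]/(val (Ordinal im)) val_eqE.
  by rewrite (negbTE ne).
(* The l-th term is p^l times a series in z: only l = j contributes. *)
- exists j.+1 => m jm; rewrite fps2_coef_sum (bigD1 (Ordinal jm)) //=.
  rewrite level_termE // big1 ?addr0 => [|l ne].
    by rewrite /fps2_coef fps_coefXnM leqnn subnn.
  rewrite level_termE // /fps2_coef fps_coefXnM.
  case: ifP => lj; last by rewrite fps_coef0.
  rewrite {2}/fps_coef /= subn_eq0 ifF ?fps_coef0 //; apply/negbTE.
  by rewrite -ltnNge ltn_neqAle lj andbT.
Qed.
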